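(* Let $n\in\mathbb N^+$, let $k\ge 2$ be an integer with $k\le n^{0.001}$, let $\ell\le n^{0.001}$, and let $d=cn$ for a constant $c\in(0,1/2]$. Let $\mathcal F_{n,\ell}$ be the set of maps from symmetric $n\times n$ real matrices to symmetric $n\times n$ real matrices each of whose entries is a polynomial of degree at most $\ell$ in the entries of the input. Then there is a constant $C>0$ such that for all sufficiently large $n$, $$\min_{f\in\mathcal F_{n,\ell}}\ \max_{\epsilon\in[0,1]}\ \mathbb E_{(Y,\theta^\circ)\sim\mathrm{SSBM}(n,\frac dn,\epsilon,k)}\|f(Y)-\theta^\circ\|_F^2\ \ge\ C\,k\,n,$$ where $Y$ is the adjacency matrix and $\theta^\circ$ the edge connection probability matrix of the sampled model.
   Context: $\mathrm{SSBM}(n,\frac{d}{n},\epsilon,k)$ ($n$ a multiple of $k$): each vertex gets a label $x^\circ_i\in[k]$ independently and uniformly; edges are added independently with probability $(1+\frac{k-1}{k}\epsilon)\frac dn$ if $x^\circ_i=x^\circ_j$ and $(1-\frac\epsilon k)\frac dn$ otherwise. Edge connection probability matrix: $\theta^\circ_{i,j}=(1+\frac{(k-1)\epsilon}{k})\frac dn$ if $x^\circ_i=x^\circ_j$ and $(1-\frac\epsilon k)\frac dn$ otherwise. *)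

(* Defs.v *)
From HB Require Import structures.
From mathcomp Require Import all_boot all_order all_algebra.
From mathcomp Require Import reals.
From mathcomp Require Import mpoly.
Set Implicit Arguments. Unset Strict Implicit. Unset Printing Implicit Defensive.
Import Order.TTheory GRing.Theory Num.Theory.
Local Open Scope ring_scope.

Section SSBM.
Variable R : realType.

(* Edge connection probability of SSBM(n, d/n, eps, k) with d/n = c. *)
Definition ssbm_entry (n k : nat) (c eps : R) (x : {ffun 'I_n -> 'I_k}) (i j : 'I_n) : R :=
  if x i == x j then (1 + (k.-1)%:R * eps / k%:R) * c
  else (1 - eps / k%:R) * c.

Definition ssbm_theta (n k : nat) (c eps : R) (x : {ffun 'I_n -> 'I_k}) : 'M[R]_n :=
  \matrix_(i, j) ssbm_entry c eps x i j.

(* unordered pairs {i,j}, i <> j, represented as (i,j) with i < j *)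
Definition upper_pairs (n : nat) : {set 'I_n * 'I_n} := [set p : 'I_n * 'I_n | (val p.1 < val p.2)%N].

Definition adjacency (n : nat) (E : {set 'I_n * 'I_n}) : 'M[R]_n :=
  \matrix_(i, j) (if ((i, j) \in E) || ((j, i) \in E) then 1 else 0).

Definition graph_prob (n k : nat) (c eps : R) (x : {ffun 'I_n -> 'I_k})
    (E : {set 'I_n * 'I_n}) : R :=
  \prod_(p in upper_pairs n)
    (if p \in E then ssbm_entry c eps x p.1 p.2 else 1 - ssbm_entry c eps x p.1 p.2).

Definition frob2 (n : nat) (A : 'M[R]_n) : R := \sum_i \sum_j (A i j) ^+ 2.

Definition ssbm_risk (n k : nat) (c eps : R) (f : 'M[R]_n -> 'M[R]_n) : R :=
  \sum_(x : {ffun 'I_n -> 'I_k})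
    (k%:R ^-1) ^+ n *
    \sum_(E : {set 'I_n * 'I_n} | E \subset upper_pairs n)
       graph_prob c eps x E * frob2 (f (adjacency E) - ssbm_theta c eps x).

Definition poly_map_deg (n l : nat) (f : 'M[R]_n -> 'M[R]_n) : Prop :=
  exists P : 'I_n -> 'I_n -> {mpoly R[n * n]},
    (forall i j, (msize (P i j) <= l.+1)%N) /\
    (forall Y : 'M[R]_n, Y^T = Y ->
       (f Y)^T = f Y /\
       forall i j, f Y i j = (P i j).@[fun m => mxvec Y 0 m]).

End SSBM.

(* Main.v *)
Require Import Defs.
From HB Require Import structures.
From mathcomp Require Import all_boot all_order all_algebra.
From mathcomp Require Import reals.
From mathcomp Require Import mpoly.
From mathcomp Require Import ring lra zify.
Import Order.TTheory GRing.Theory Num.Theory.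
Local Open Scope ring_scope.
Set Implicit Arguments.
Unset Strict Implicit.
Unset Printing Implicit Defensive.

(** Take eps = k / (8 sqrt n), a small constant factor below the Kesten-Stigum threshold.
    Fix i <> j and write w_p = theta_p - c. If h(x, Y) satisfies E[h phi] = E[w_ij phi] for
    every polynomial phi(Y) of degree at most l, then
    E(g - w_ij)^2 = E(g - h)^2 + E w_ij^2 - E h^2 >= E w_ij^2 - E h^2
    for all such g, so it suffices to find h with E h^2 <= (1/4) lam^2, where
    lam = eps c / k and E w_ij^2 = lam^2 (k - 1). In the orthogonal basis
    psi_T = prod_(p in T) (Y_p - theta_p) / (theta_p (1 - theta_p)) (conditionally on x), the
    function h = sum_T a_T(x) psi_T must satisfy
    sum_(T subset S) E[a_T w_(S \ T)] = E[w_ij w_S] for |S| <= l.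

    Such coefficients are built by exploring the graph from {i, j}. The state is a function F
    of the labels with conditional mean zero in each label of an active set A. Averaging over
    the label of some i in A and expanding in the edges {i, u}, u in N, replaces F by its
    conditional cumulant along N, which has mean zero in the newly met labels.
    One new neighbour costs a factor n lam^2 O(1) <= 1/2; m new neighbours gain eta^(m-1), as the
    active set grows; meeting an already visited vertex costs powers of 1/eta, but has
    probability O(l/n). With eta = (k (l + 3))^-6 the total is at most eta^|A| sup|F|^2 by
    induction on l, and |A| = 2 initially. *)

(** * Sums over the subsets of a finite set *)

Section SubsetSums.
Variables (R : comNzRingType) (P : finType).
Implicit Types (A S T : {set P}) (f g : P -> R) (F : {set P} -> R).

Lemma prod_add_subset S f g :
  \prod_(p in S) (f p + g p) =
  \sum_(T : {set P} | T \subset S) (\prod_(p in T) f p) * \prod_(p in S :\: T) g p.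
Proof.
(* Factors outside [S] are written as [0 + 1], so that full distributivity applies and every subset
   not contained in [S] contributes zero. *)
have -> : \prod_(p in S) (f p + g p) =
   \prod_p ((if p \in S then f p else 0) + (if p \in S then g p else 1)).
  by rewrite big_mkcond; apply: eq_bigr => p _; case: ifP; rewrite ?add0r.
rewrite bigA_distr [RHS]big_mkcond; apply: eq_bigr => T _.
case: ifPn => [sTS | /subsetPn [p pT pS]].
  rewrite [X in X * _]big_mkcond [X in _ * X]big_mkcond -big_split.
  apply: eq_bigr => p _; rewrite inE; case: ifPn => pT /=.
    by rewrite (subsetP sTS) // mulr1.
  by rewrite mul1r.
by rewrite (bigD1 p) //= pT (negPf pS) mul0r.
Qed.

Lemma sum_subset_addl A S F : A \subset S ->
  \sum_(T : {set P} | (A \subset T) && (T \subset S)) F T =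
  \sum_(T : {set P} | T \subset S :\: A) F (A :|: T).
Proof.
move=> sAS.
rewrite (reindex_onto (fun T => A :|: T) (fun T => T :\: A)) /=; last first.
  by move=> T /andP[sAT _]; apply/setP => p; rewrite !inE; case: (boolP (p \in A)) => //= pA; rewrite (subsetP sAT).
apply: eq_bigl => T; apply/idP/idP.
  case/andP=> /andP[_]; rewrite subUset => /andP[_ sTS] /eqP <-.
  by apply/subsetP => p; rewrite !inE; case: (p \in A) => //= /(subsetP sTS).
move=> sTSA; have [sTS dTA] : T \subset S /\ [disjoint T & A] by apply/andP; rewrite -subsetD.
rewrite subsetUl subUset sAS sTS /=; apply/eqP/setP => p; rewrite !inE.
case: (boolP (p \in A)) => //= pA; apply/esym/negbTE.
by apply/negP => /(disjointFr dTA); rewrite pA.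
Qed.

End SubsetSums.

(** * Elementary inequalities for sums, products and powers *)

Section ElementarySums.
Variables (R : realFieldType) (P : finType).

Lemma sqr_sum_le (J : pred P) (b : P -> R) :
  (\sum_(i | J i) b i) ^+ 2 <= #|J|%:R * \sum_(i | J i) b i ^+ 2.
Proof.
have -> : #|J|%:R * \sum_(i | J i) b i ^+ 2 =
    \sum_(i | J i) \sum_(j | J j) (b i ^+ 2 + b j ^+ 2) / 2.
  transitivity (\sum_(i | J i) (b i ^+ 2 * #|J|%:R + \sum_(j | J j) b j ^+ 2) / 2).
    by rewrite -mulr_suml big_split /= -mulr_suml sumr_const -[_ *+ _]mulr_natl; field.
  apply: eq_bigr => i _; rewrite -mulr_suml big_split /=; congr ((_ + _) / 2).
  by rewrite sumr_const -[in RHS]mulr_natr.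
rewrite expr2 mulr_suml; apply: ler_sum => i _; rewrite mulr_sumr; apply: ler_sum => j _.
by have := sqr_ge0 (b i - b j); rewrite !expr2; lra.
Qed.

(** Beyond its linear part the product is quadratically small. In [star_sum_le] this excess is the
    contribution of neighbourhoods with at least two vertices. *)
Lemma prod_add1_le (r : seq P) (g : P -> R) : (forall u, 0 <= g u) ->
  \sum_(u <- r) g u <= 1 ->
  \prod_(u <- r) (g u + 1) <= 1 + \sum_(u <- r) g u + (\sum_(u <- r) g u) ^+ 2.
Proof.
move=> g0; elim: r => [|v r IH]; first by rewrite !big_nil; lra.
rewrite !big_cons; set s := \sum_(u <- r) g u; move=> h.
have s0 : 0 <= s by apply: sumr_ge0.
have := g0 v => gv0.
have /IH h1 : s <= 1 by lra.
apply: (@le_trans _ _ ((g v + 1) * (1 + s + s ^+ 2))); first by apply: ler_wpM2l => //; lra.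
have : 0 <= g v * s * (1 - s) by rewrite !mulr_ge0 //; lra.
have : 0 <= g v * g v by rewrite mulr_ge0.
have : 0 <= g v * s by rewrite mulr_ge0.
rewrite !expr2; lra.
Qed.

End ElementarySums.

Lemma geometric_shift (R : realFieldType) (G : R) (m : nat) :
  0 < G -> m.*2%:R <= G -> (1 + G) ^+ m <= 2 * G ^+ m.
Proof.
(* The form that passes through the induction is (1 + 1/G)^m <= 1 + 2m/G, cleared of
   denominators. *)
move=> G0 hm; suff : (1 + G) ^+ m * G <= (G + m.*2%:R) * G ^+ m.
  move=> h; rewrite -(ler_pM2r G0); apply: (le_trans h).
  rewrite [leRHS]mulrAC; apply: ler_wpM2r; first by rewrite exprn_ge0 // ltW.
  lra.
elim: m hm => [|m IH] hm; first by rewrite !expr0 double0 mul1r addr0 mulr1.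
have e : m.+1.*2%:R = m.*2%:R + 2 :> R by rewrite doubleS -addn2 natrD.
rewrite e in hm *.
have := IH ltac:(lra) => {}IH.
rewrite !exprS -mulrA; apply: (@le_trans _ _ ((1 + G) * ((G + m.*2%:R) * G ^+ m))).
  by apply: ler_wpM2l => //; lra.
rewrite !mulrA; apply: ler_wpM2r; first by apply: exprn_ge0; lra.
have := ler0n R m.*2; nra.
Qed.

(** * Uniform labels: the mean, and averaging over the label of one vertex *)

Section Labels.
Variables (R : realFieldType) (n k : nat).
Hypothesis k_gt0 : (0 < k)%N.
Notation lab := {ffun 'I_n -> 'I_k}.
Implicit Types (x : lab) (f g F : lab -> R) (u v i : 'I_n).

Definition relabel x u (b : 'I_k) : lab := [ffun v => if v == u then b else x v].

Definition label_mean g : R := \sum_x (k%:R^-1) ^+ n * g x.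

Definition cond_mean u g x : R := k%:R^-1 * \sum_b g (relabel x u b).

Definition indep u g := forall x b, g (relabel x u b) = g x.

Lemma relabelE x u b : relabel x u b u = b.
Proof. by rewrite ffunE eqxx. Qed.

Lemma relabel_neq x u v b : v != u -> relabel x u b v = x v.
Proof. by rewrite ffunE => /negPf ->. Qed.

Lemma relabel_twice x u b b' : relabel (relabel x u b) u b' = relabel x u b'.
Proof. by apply/ffunP => v; rewrite !ffunE; case: eqP. Qed.

Lemma relabel_id x u : relabel x u (x u) = x.
Proof. by apply/ffunP => v; rewrite ffunE; case: eqP => [->|]. Qed.

Lemma relabelC x u v b b' : u != v ->
  relabel (relabel x u b) v b' = relabel (relabel x v b') u b.
Proof.
move=> uv; apply/ffunP => t; rewrite !ffunE.
by case: (eqVneq t v) => // ->; rewrite eq_sym (negPf uv).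
Qed.

Lemma eq_label_mean f g : f =1 g -> label_mean f = label_mean g.
Proof. by move=> e; apply: eq_bigr => x _; rewrite e. Qed.

Lemma eq_cond_mean u f g : f =1 g -> cond_mean u f =1 cond_mean u g.
Proof. by move=> e x; congr (_ * _); apply: eq_bigr => b _; rewrite e. Qed.

Lemma label_mean_sum (I : Type) (r : seq I) (J : pred I) (G : I -> lab -> R) :
  label_mean (fun x => \sum_(a <- r | J a) G a x) = \sum_(a <- r | J a) label_mean (G a).
Proof. by rewrite exchange_big; apply: eq_bigr => x _; rewrite mulr_sumr. Qed.

Lemma label_mean_ge0 g : (forall x, 0 <= g x) -> 0 <= label_mean g.
Proof. by move=> g0; apply: sumr_ge0 => x _; rewrite mulr_ge0 // exprn_ge0 // invr_ge0. Qed.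

Lemma label_mean_le f g : (forall x, f x <= g x) -> label_mean f <= label_mean g.
Proof.
by move=> h; apply: ler_sum => x _; rewrite ler_wpM2l // exprn_ge0 // invr_ge0.
Qed.

Lemma label_meanZ c g : label_mean (fun x => c * g x) = c * label_mean g.
Proof. by rewrite mulr_sumr; apply: eq_bigr => x _; rewrite mulrCA. Qed.

Lemma label_mean_cst c : label_mean (fun=> c) = c.
Proof.
rewrite /label_mean sumr_const card_ffun !card_ord -[LHS]mulr_natr natrX mulrAC -exprMn mulVf.
  by rewrite expr1n mul1r.
by rewrite pnatr_eq0 -lt0n.
Qed.

Lemma label_mean_cond u g : label_mean (cond_mean u g) = label_mean g.
Proof.
rewrite /label_mean -!mulr_sumr; congr (_ * _).
rewrite /cond_mean -?mulr_sumr pair_big /=.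
have k0 : k%:R != 0 :> R by rewrite pnatr_eq0 -lt0n.
apply: (mulfI k0); rewrite mulVKf //.
(* [tau] exchanges the label of [u] with the fresh label, so reindexing by it removes the
   relabelling. *)
pose tau (p : lab * 'I_k) := (relabel p.1 u p.2, p.1 u).
have tauK : involutive tau.
  by case=> x b; rewrite /tau /= relabelE relabel_twice relabel_id.
rewrite (reindex_inj (inv_inj tauK)) /=.
under eq_bigr => p _ do rewrite relabel_twice relabel_id.
rewrite -(pair_big xpredT xpredT (fun x (_ : 'I_k) => g x)) /=.
by under eq_bigr => x _ do rewrite sumr_const card_ord -mulr_natl; rewrite mulr_sumr.
Qed.

Lemma indep_cond u g : indep u (cond_mean u g).
Proof. move=> x b; rewrite /cond_mean. by congr (k%:R^-1 * _); apply: eq_bigr => b' _; rewrite relabel_twice. Qed.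

Lemma indep_cond_neq u v g : u != v -> indep v g -> indep v (cond_mean u g).
Proof.
move=> uv hg x b; rewrite /cond_mean; congr (k%:R^-1 * _); apply: eq_bigr => b' _.
by rewrite relabelC 1?eq_sym // hg.
Qed.

Lemma indepM u f g : indep u f -> indep u g -> indep u (fun x => f x * g x).
Proof. by move=> hf hg x b; rewrite hf hg. Qed.

Lemma cond_meanMl u f g : indep u f ->
  cond_mean u (fun x => f x * g x) =1 (fun x => f x * cond_mean u g x).
Proof.
move=> hf x; rewrite /cond_mean /= [RHS]mulrCA [in RHS]mulr_sumr; congr (k%:R^-1 * _).
by apply: eq_bigr => b _; rewrite hf.
Qed.

Lemma cond_meanMr u f g : indep u f ->
  cond_mean u (fun x => g x * f x) =1 (fun x => cond_mean u g x * f x).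
Proof.
by move=> hf x; rewrite /= mulrC -cond_meanMl //; apply: eq_cond_mean => y; rewrite mulrC.
Qed.

Lemma cond_mean_cst u c x : cond_mean u (fun=> c) x = c.
Proof.
rewrite /cond_mean sumr_const card_ord -(mulr_natl c) mulKf //.
by rewrite pnatr_eq0 -lt0n.
Qed.

Lemma cond_mean_swap u v g : u != v ->
  cond_mean u (cond_mean v g) =1 cond_mean v (cond_mean u g).
Proof.
move=> uv x; rewrite /cond_mean -!mulr_sumr exchange_big /=; congr (_ * (_ * _)).
by apply: eq_bigr => b _; apply: eq_bigr => b' _; rewrite relabelC.
Qed.

Lemma cond_mean_norm_le u g B : (forall x, `|g x| <= B) -> forall x, `|cond_mean u g x| <= B.
Proof.
move=> h x; rewrite -[B](cond_mean_cst u B x) /cond_mean normrM ger0_norm ?invr_ge0 //.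
by rewrite ler_wpM2l ?invr_ge0 //; apply: (le_trans (ler_norm_sum _ _ _)); apply: ler_sum.
Qed.

Lemma cond_mean_norm u g x : `|cond_mean u g x| <= cond_mean u (fun y => `|g y|) x.
Proof.
rewrite /cond_mean normrM ger0_norm ?invr_ge0 // ler_wpM2l ?invr_ge0 //.
exact: ler_norm_sum.
Qed.

Lemma cond_meanB u f g x :
  cond_mean u (fun y => f y - g y) x = cond_mean u f x - cond_mean u g x.
Proof. by rewrite /cond_mean sumrB mulrBr. Qed.

Lemma cond_mean_sum u (I : Type) (r : seq I) (J : pred I) (G : I -> lab -> R) x :
  cond_mean u (fun y => \sum_(a <- r | J a) G a y) x = \sum_(a <- r | J a) cond_mean u (G a) x.
Proof. by rewrite /cond_mean exchange_big mulr_sumr. Qed.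

End Labels.

(** * Conditional cumulants along the star of a vertex *)

Section Cumulants.
Variables (R : realFieldType) (n k : nat).
Hypothesis k_gt0 : (0 < k)%N.
Notation lab := {ffun 'I_n -> 'I_k}.
Variables (W : 'I_k -> 'I_k -> R) (i : 'I_n) (F : lab -> R).
Hypothesis W_mean0 : forall a, \sum_b W a b = 0.
Implicit Types (N M : {set 'I_n}) (u v : 'I_n) (x : lab).

Definition star_weight N x : R := \prod_(u in N) W (x i) (x u).

Lemma star_weight0 x : star_weight set0 x = 1.
Proof. by rewrite /star_weight big_set0. Qed.

Lemma indep_star v N : v != i -> v \notin N -> indep v (star_weight N).
Proof.
move=> vi vN x b; apply: eq_bigr => u uN; rewrite !relabel_neq 1?eq_sym //.
by apply: contraNneq vN => ->.
Qed.

Lemma cond_mean_edge v x : v != i -> cond_mean v (fun y : lab => W (y i) (y v)) x = 0.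
Proof.
move=> vi; rewrite /cond_mean.
under eq_bigr => b _ do rewrite relabelE relabel_neq 1?eq_sym //.
by rewrite W_mean0 mulr0.
Qed.

Lemma cond_mean_star v N x : v != i -> v \in N -> cond_mean v (star_weight N) x = 0.
Proof.
move=> vi vN.
have e : star_weight N =1 (fun y => star_weight (N :\ v) y * W (y i) (y v)).
  by move=> y; rewrite /star_weight (bigD1 v) //= mulrC; congr (_ * _); apply: eq_bigl => u; rewrite !inE andbC.
rewrite (eq_cond_mean _ e) cond_meanMl ?cond_mean_edge ?mulr0 //.
by apply: indep_star; rewrite // !inE eqxx.
Qed.

Definition star_moment N := cond_mean i (star_weight N).

Definition target_moment N := cond_mean i (fun x => F x * star_weight N x).

(** Solves the triangular system of [sum_cumulant] for the unknowns indexed by subsets of [N]: the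
    diagonal coefficient is [star_moment set0], which is 1. *)
Fixpoint cumulant_rec m N x : R :=
  if m is m'.+1 then
    target_moment N x -
    \sum_(M : {set 'I_n} | M \proper N) cumulant_rec m' M x * star_moment (N :\: M) x
  else target_moment N x.

(* Fuel [n] suffices: it bounds the length of every strict chain of subsets. *)
Definition cumulant := cumulant_rec n.

Lemma cumulant_rec_stable m N x : (#|N| <= m)%N -> cumulant_rec m.+1 N x = cumulant_rec m N x.
Proof.
elim: m N => [|m IH] N hN.
  rewrite /= big1 ?subr0 // => M /proper_card; lia.
rewrite /=; congr (_ - _); apply: eq_bigr => M pM; congr (_ * _).
by apply: IH; have := proper_card pM; lia.
Qed.

Lemma cumulantE N x :
  cumulant N x = target_moment N x -
    \sum_(M : {set 'I_n} | M \proper N) cumulant M x * star_moment (N :\: M) x.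
Proof. by rewrite /cumulant -cumulant_rec_stable //; have := max_card (mem N); rewrite card_ord. Qed.

Lemma star_moment0 x : star_moment set0 x = 1.
Proof. by rewrite /star_moment (eq_cond_mean _ star_weight0) cond_mean_cst. Qed.

Lemma sum_cumulant N x :
  \sum_(M : {set 'I_n} | M \subset N) cumulant M x * star_moment (N :\: M) x = target_moment N x.
Proof.
rewrite (bigD1 N) //= setDv star_moment0 mulr1 cumulantE.
rewrite [X in _ - X + _](eq_bigl (fun M => (M \subset N) && (M != N))) ?subrK //.
by move=> M; rewrite properEneq andbC.
Qed.

Lemma cumulant_ind (Pr : {set 'I_n} -> Prop) :
  (forall N, (forall M, M \proper N -> Pr M) -> Pr N) -> forall N, Pr N.
Proof.
move=> h N; have [m] := ubnP #|N|; elim: m N => // m IH N hm; apply: h => M pM.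
by apply: IH; have := proper_card pM; lia.
Qed.

Lemma indep_cumulant_center N : indep i (cumulant N).
Proof.
elim/cumulant_ind: N => N IH x b; rewrite !cumulantE /target_moment indep_cond; congr (_ - _).
by apply: eq_bigr => M pM; rewrite IH // /star_moment indep_cond.
Qed.

Lemma indep_star_moment v N : v != i -> v \notin N -> indep v (star_moment N).
Proof. by move=> vi vN; apply: indep_cond_neq; rewrite 1?eq_sym //; apply: indep_star. Qed.

Lemma indep_cumulant v N : v != i -> v \notin N -> indep v F -> indep v (cumulant N).
Proof.
move=> vi vN hF; elim/cumulant_ind: N vN => N IH vN x b; rewrite !cumulantE.
congr (_ - _); first apply: indep_cond_neq; rewrite 1?eq_sym //.
  by apply: indepM => //; apply: indep_star.
apply: eq_bigr => M pM; have vM : v \notin M by apply: contraNN vN; apply/subsetP/proper_sub.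
by rewrite IH // indep_star_moment // inE negb_and vN orbT.
Qed.

(** Active vertices that are not hit stay active: averaging over [v] commutes with averaging over
    [i], and the star weights do not involve [v]. *)
Lemma cond_mean_cumulant_out v N : v != i -> v \notin N ->
  (forall x, cond_mean v F x = 0) -> forall x, cond_mean v (cumulant N) x = 0.
Proof.
move=> vi vN hF; elim/cumulant_ind: N vN => N IH vN x.
rewrite (eq_cond_mean _ (cumulantE N)) cond_meanB cond_mean_sum big1 ?subr0.
  rewrite cond_mean_swap //.
  rewrite (@eq_cond_mean _ _ _ _ _ (fun=> 0)) ?cond_mean_cst // => y.
  by rewrite cond_meanMr ?hF ?mul0r //; apply: indep_star.
move=> M pM; have vM : v \notin M by apply: contraNN vN; apply/subsetP/proper_sub.
rewrite cond_meanMr ?IH ?mul0r //.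
by apply: indep_star_moment; rewrite // inE negb_and vN orbT.
Qed.

Lemma cond_mean_star_moment v N x : v != i -> v \in N -> cond_mean v (star_moment N) x = 0.
Proof.
move=> vi vN; rewrite cond_mean_swap //.
rewrite (@eq_cond_mean _ _ _ _ _ (fun=> 0)) ?cond_mean_cst // => y.
exact: cond_mean_star.
Qed.

(** Newly met vertices become active. In each product of the recursion exactly one factor involves
    [v]: the smaller cumulant, centred by induction, or the star moment, centred because [W] is. *)
Lemma cond_mean_cumulant_in v N : v != i -> v \in N -> indep v F ->
  forall x, cond_mean v (cumulant N) x = 0.
Proof.
move=> vi vN hF; elim/cumulant_ind: N vN => N IH vN x.
rewrite (eq_cond_mean _ (cumulantE N)) cond_meanB cond_mean_sum big1 ?subr0.
  rewrite cond_mean_swap //.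
  rewrite (@eq_cond_mean _ _ _ _ _ (fun=> 0)) ?cond_mean_cst // => y.
  by rewrite cond_meanMl ?cond_mean_star ?mulr0.
move=> M pM; have [vM | vM] := boolP (v \in M).
  rewrite cond_meanMr ?IH ?mul0r //.
  by apply: indep_star_moment; rewrite // inE vM.
rewrite cond_meanMl ?cond_mean_star_moment ?mulr0 // ?inE ?vM //.
exact: indep_cumulant.
Qed.

Hypothesis F_mean0 : forall x, cond_mean i F x = 0.

(** Because [F] is centred in the label of [i], the exploration from [i] must use at least one edge;
    this drives the induction on the degree. *)
Lemma cumulant0 x : cumulant set0 x = 0.
Proof.
rewrite cumulantE big1 ?subr0; last by move=> M; rewrite properE sub0set andbF.
rewrite -(F_mean0 x); apply: eq_cond_mean => y; by rewrite star_weight0 mulr1.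
Qed.

Variables (mu B : R).
Hypothesis W_mean_abs : forall b, k%:R^-1 * \sum_a `|W a b| <= mu.
Hypothesis F_bound : forall x, `|F x| <= B.
Hypothesis B_ge0 : 0 <= B.

(** For one neighbour no correction term survives, so the mean [mu] of |W| replaces its supremum
    [kap]. For the block model this saves a factor of order k, as needed to reach the Kesten-Stigum
    scale. *)
Lemma cumulant1_bound u x : u != i -> `|cumulant [set u] x| <= B * mu.
Proof.
move=> ui; rewrite cumulantE (bigD1 set0) /=; last first.
  by rewrite properEcard sub0set cards0 cards1.
rewrite cumulant0 mul0r add0r big1 ?subr0; last first.
  move=> M /andP[/proper_card]; rewrite cards1 -cards_eq0; lia.
apply: (le_trans (cond_mean_norm _ _ _)).
apply: (@le_trans _ _ (B * (k%:R^-1 * \sum_a `|W a (x u)|))); last by rewrite ler_wpM2l.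
rewrite /cond_mean [leRHS]mulrCA ler_wpM2l ?invr_ge0 // mulr_sumr.
apply: ler_sum => a _; rewrite normrM ler_pM //.
by rewrite /star_weight big_set1 relabelE relabel_neq.
Qed.

Variable kap : R.
Hypothesis W_bound : forall a b, `|W a b| <= kap.
Hypothesis kap_ge0 : 0 <= kap.

Lemma star_weight_bound N x : `|star_weight N x| <= kap ^+ #|N|.
Proof.
rewrite normr_prod -prodr_const.
by apply: ler_prod => u _; rewrite normr_ge0 W_bound.
Qed.

(** By induction the recursion is bounded by a binomial sum in [G] without its top term, and
    [geometric_shift] bounds that by a single power of [G]. *)
Lemma cumulant_bound G N x : 0 < G -> #|N|.*2%:R <= G ->
  `|cumulant N x| <= B * (G * kap) ^+ #|N|.
Proof.
move=> G0; elim/cumulant_ind: N => N IH hN.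
have [-> | N0] := eqVneq N set0.
  by rewrite cumulant0 normr0 cards0 expr0 mulr1.
rewrite cumulantE (bigD1 set0) /=; last by rewrite properE sub0set subset0.
rewrite cumulant0 mul0r add0r; apply: (le_trans (ler_normB _ _)).
have tb M : `|target_moment M x| <= B * kap ^+ #|M|.
  by apply: cond_mean_norm_le => // y; rewrite normrM ler_pM // star_weight_bound.
have sb M : `|star_moment M x| <= kap ^+ #|M|.
  by apply: cond_mean_norm_le => // y; apply: star_weight_bound.
have hs : `|\sum_(M : {set 'I_n} | (M \proper N) && (M != set0))
     cumulant M x * star_moment (N :\: M) x| <=
   B * kap ^+ #|N| * \sum_(M : {set 'I_n} | (M \proper N) && (M != set0)) G ^+ #|M|.
  apply: (le_trans (ler_norm_sum _ _ _)); rewrite mulr_sumr; apply: ler_sum => M /andP[pM _].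
  have hM : #|M|.*2%:R <= G.
    apply: le_trans hN; rewrite ler_nat leq_double; exact/subset_leq_card/proper_sub.
  rewrite normrM; apply: (le_trans (ler_pM _ _ (IH M pM hM) (sb _))) => //.
  have -> : #|N| = (#|M| + #|N :\: M|)%N.
    by rewrite cardsD (setIidPr (proper_sub pM)) subnKC // subset_leq_card // proper_sub.
  rewrite exprMn exprD.
  by rewrite (_ : _ * _ * _ = B * (kap ^+ #|M| * kap ^+ #|N :\: M|) * G ^+ #|M|) //; ring.
(* The binomial expansion of (1 + G)^|N|, less the terms of [N] and of the empty set. *)
have total : \sum_(M : {set 'I_n} | (M \proper N) && (M != set0)) G ^+ #|M| =
    (1 + G) ^+ #|N| - G ^+ #|N| - 1.
  have := prod_add_subset N (fun=> G) (fun=> 1); rewrite prodr_const addrC => ->.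
  rewrite [in RHS](bigD1 N) //= [in RHS](bigD1 set0) /=; last by rewrite sub0set eq_sym.
  rewrite setDv big_set0 setD0 big_set0.
  rewrite !prodr_const !expr1n !mulr1.
  have cancel2 (a s : R) : a + (1 + s) - a - 1 = s by ring.
  rewrite cancel2.
  apply: eq_big => [M | M _]; last by rewrite !prodr_const expr1n mulr1.
  by rewrite properEneq (andbC (M != N)).
rewrite total in hs.
apply: (le_trans (lerD (tb N) hs)).
have -> : B * kap ^+ #|N| + B * kap ^+ #|N| * ((1 + G) ^+ #|N| - G ^+ #|N| - 1) =
   B * kap ^+ #|N| * ((1 + G) ^+ #|N| - G ^+ #|N|) by ring.
rewrite exprMn; have := geometric_shift G0 hN => hg.
have -> : B * (G ^+ #|N| * kap ^+ #|N|) = B * kap ^+ #|N| * G ^+ #|N| by ring.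
by rewrite ler_wpM2l ?mulr_ge0 ?exprn_ge0 //; lra.
Qed.

End Cumulants.

(** * Splitting an edge set at a vertex into its star and the rest *)

Section Edges.
Variable n : nat.
Implicit Types (i u v : 'I_n) (p : 'I_n * 'I_n) (N : {set 'I_n}) (S T : {set 'I_n * 'I_n}).

Definition edge u v : 'I_n * 'I_n := if (u < v)%N then (u, v) else (v, u).

Definition star i N : {set 'I_n * 'I_n} := [set edge i u | u in N].

Definition nb i S : {set 'I_n} := [set u | edge i u \in S].

Definition rest i S : {set 'I_n * 'I_n} := [set p in S | (p.1 != i) && (p.2 != i)].

Lemma edge_inj i : injective (edge i).
Proof.
by move=> u v; rewrite /edge; do 2 case: ifP => _; case => // -> ->.
Qed.

Lemma edge_fst_or i u : (edge i u == (i, u)) || (edge i u == (u, i)).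
Proof. by rewrite /edge; case: ifP; rewrite eqxx ?orbT. Qed.

Lemma card_star i N : #|star i N| = #|N|.
Proof. by rewrite card_imset //; apply: edge_inj. Qed.

Lemma star_sub i N S : (star i N \subset S) = (N \subset nb i S).
Proof.
apply/subsetP/subsetP => [h u uN | h _ /imsetP[u uN ->]].
  by rewrite inE; apply: h; apply: imset_f.
by have := h u uN; rewrite inE.
Qed.

Lemma edge_upper i u : u != i -> edge i u \in upper_pairs n.
Proof.
move=> ui; have : (u : nat) != i by [].
by rewrite /edge inE; case: (ltngtP i u) => //= h; rewrite ?h.
Qed.

Lemma star_upper i N : i \notin N -> star i N \subset upper_pairs n.
Proof.
move=> iN; apply/subsetP => _ /imsetP[u uN ->]; apply: edge_upper.
by apply: contraNneq iN => <-.
Qed.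

Lemma nb_center i S : S \subset upper_pairs n -> i \notin nb i S.
Proof.
move=> /subsetP sS; apply/negP; rewrite inE => /sS.
by rewrite inE /edge ltnn /= ltnn.
Qed.

Lemma star_in_rest i N S : [disjoint star i N & rest i S].
Proof.
rewrite disjoint_subset; apply/subsetP => _ /imsetP[u _ ->].
rewrite !inE; have /orP[] := edge_fst_or i u => /eqP ->;
  by rewrite /= eqxx ?andbF.
Qed.

Lemma star_rest i S : S \subset upper_pairs n -> S = star i (nb i S) :|: rest i S.
Proof.
move=> /subsetP sS; apply/setP => p; rewrite inE.
apply/idP/orP => [pS | [/imsetP[u] | ]]; last 2 first.
- by rewrite inE => h ->.
- by rewrite inE => /andP[].
have := sS p pS; rewrite inE; case: p pS => a b pS /= ab.
have [ea | ai] := eqVneq a i.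
  left; apply/imsetP; exists b; rewrite ?inE /edge -ea ab //.
have [eb | bi] := eqVneq b i.
  left; apply/imsetP; exists a; rewrite ?inE /edge -eb ltnNge (ltnW ab) //.
by right; rewrite inE pS /= ai bi.
Qed.

Lemma prod_star_rest (R : comNzRingType) i S (f : 'I_n * 'I_n -> R) : S \subset upper_pairs n ->
  \prod_(p in S) f p = (\prod_(u in nb i S) f (edge i u)) * \prod_(p in rest i S) f p.
Proof.
move=> sS; rewrite {1}(star_rest i sS).
rewrite (eq_bigl _ _ (fun p => in_setU p _ _)) bigU /=.
  by congr (_ * _); rewrite /star big_imset // => u v _ _; apply: edge_inj.
exact: star_in_rest.
Qed.

Lemma nb_setD_star i N S : nb i (S :\: star i N) = nb i S :\: N.
Proof. by apply/setP => u; rewrite !inE (mem_imset _ _ (@edge_inj i)). Qed.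

Lemma rest_setD_star i N S : rest i (S :\: star i N) = rest i S.
Proof.
apply/setP => p; rewrite !inE -andbA; case: (boolP (p \in star i N)) => //= pN.
have := disjointFr (star_in_rest i N S) pN; rewrite inE => ->.
by [].
Qed.

End Edges.

(** * The corresponding factorization of edge weights *)

Section EdgeWeights.
Variables (R : realFieldType) (n k : nat).
Hypothesis k_gt0 : (0 < k)%N.
Notation lab := {ffun 'I_n -> 'I_k}.
Variables (W : 'I_k -> 'I_k -> R).
Hypothesis W_sym : forall a b, W a b = W b a.
Implicit Types (S T : {set 'I_n * 'I_n}) (x : lab).

Definition edge_weight S x : R := \prod_(p in S) W (x p.1) (x p.2).

Lemma edge_weight_star i S x : S \subset upper_pairs n ->
  edge_weight S x = star_weight W i (nb i S) x * edge_weight (rest i S) x.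
Proof.
move=> sS; rewrite /edge_weight (prod_star_rest i) //; congr (_ * _).
by apply: eq_bigr => u _; rewrite /edge; case: ifP.
Qed.

Lemma indep_edge_weight_rest i S : indep i (edge_weight (rest i S)).
Proof.
by move=> x b; apply: eq_bigr => p; rewrite inE => /and3P[_ h1 h2]; rewrite !relabel_neq.
Qed.

End EdgeWeights.

(** * The total weight of one exploration step *)

Section StarSum.
Variables (R : realFieldType) (V : finType).
Implicit Types (N X : {set V}).

Lemma sum_by_card (h : {set V} -> R) :
  \sum_N h N = h set0 + \sum_u h [set u] + \sum_(N : {set V} | (1 < #|N|)%N) h N.
Proof.
rewrite (bigD1 set0) //= -addrA; congr (_ + _).
rewrite (bigID (fun N : {set V} => #|N| == 1%N)) /=; congr (_ + _).
  rewrite (eq_bigl (mem [set [set u] | u in [set: V]])).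
    by rewrite big_imset /= => [|u v _ _]; [apply: eq_bigl => u; rewrite inE | apply: set1_inj].
  move=> N; rewrite /= -cards_eq0; apply/andP/imsetP => [[_ /cards1P[u ->]]| [u _ ->]].
    by exists u.
  by rewrite cards1.
by apply: eq_bigl => N; rewrite -cards_eq0; case: #|N| => [|[|m]].
Qed.

(** The price of meeting [u], with [X] the visited vertices: a new vertex enlarges the active set
    and gains [eta], a visited one may shrink it and loses [eta]. *)
Definition tilt (eta : R) X u := if u \in X then eta^-1 else eta.

Lemma prod_tilt eta X N :
  \prod_(u in N) tilt eta X u = eta^-1 ^+ #|N :&: X| * eta ^+ #|N :\: X|.
Proof.
rewrite (big_setID X) /= -!prodr_const; congr (_ * _); apply: eq_bigr => u.
  by rewrite inE /tilt => /andP[_ ->].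
by rewrite inE /tilt => /andP[/negPf ->].
Qed.

Lemma sum_tilt eta X : 0 < eta -> \sum_u tilt eta X u <= #|V|%:R * eta + #|X|%:R / eta.
Proof.
move=> e0; rewrite (bigID (mem X)) /= addrC.
have e10 : 0 <= eta^-1 by rewrite invr_ge0 ltW.
apply: lerD.
  rewrite (eq_bigr (fun=> eta)); last by rewrite /tilt => u /negPf ->.
  by rewrite sumr_const -(mulr_natl eta) ler_wpM2r ?ler_nat ?max_card // ltW.
rewrite (eq_bigr (fun=> eta^-1)); last by rewrite /tilt => u ->.
by rewrite sumr_const -(mulr_natl eta^-1).
Qed.

(** [t] bounds the sum of all tilts. Singletons give the linear term in [mu2]; larger sets are the
    nonlinear part of a product over vertices, hence at most the square of the linear term in
    [K]. *)
Lemma star_sum_le (eta V0 mu2 K : R) (L : nat) X :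
  0 < eta -> 0 <= V0 -> 0 <= mu2 -> 0 <= K -> (#|X| <= L)%N ->
  let t := #|V|%:R * eta + L%:R / eta in
  t * (V0 * K) <= 1 -> t * (V0 * mu2) + (t * (V0 * K)) ^+ 2 <= eta ->
  \sum_(N : {set V} | N != set0)
    V0 ^+ #|N| * (\prod_(u in N) tilt eta X u) * (if #|N| == 1%N then mu2 else K ^+ #|N|) <= eta.
Proof.
move=> e0 V00 mu0 K0 hX t h1 h2.
have tilt0 u : 0 <= tilt eta X u.
  by rewrite /tilt; case: ifP => _; rewrite ?invr_ge0 ltW.
set s := \sum_u tilt eta X u.
have s0 : 0 <= s by apply: sumr_ge0.
have st : s <= t.
  apply: (le_trans (sum_tilt X e0)); by rewrite lerD2l ler_wpM2r ?ler_nat // invr_ge0 ltW.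
have VK0 : 0 <= V0 * K by rewrite mulr_ge0.
pose g u := V0 * K * tilt eta X u.
have g0 u : 0 <= g u by rewrite mulr_ge0.
have sg : \sum_u g u = V0 * K * s by rewrite mulr_sumr.
have sg1 : \sum_u g u <= 1 by rewrite sg mulrC (le_trans _ h1) // ler_wpM2r.
have := prod_add1_le g0 sg1.
(* Expanding the product lists all neighbourhoods, each vertex priced with [K]. *)
have -> : \prod_u (g u + 1) = \sum_(N : {set V}) \prod_(u in N) g u.
  have := prod_add_subset [set: V] g (fun=> 1).
  rewrite (eq_bigl xpredT); last by move=> u; rewrite inE.
  move=> ->; rewrite (eq_bigl xpredT); last by move=> N; rewrite subsetT.
  by apply: eq_bigr => N _; rewrite prodr_const expr1n mulr1.
rewrite sum_by_card big_set0 (eq_bigr g); last by move=> u _; rewrite big_set1.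
rewrite lerD2l => hbig.
rewrite (bigID (fun N : {set V} => (1 < #|N|)%N)) /= addrC.
apply: le_trans h2; apply: lerD.
  rewrite (eq_bigl (mem [set [set u] | u in [set: V]])); last first.
    move=> N; rewrite /= -cards_eq0; apply/andP/imsetP => [[n0 n1]| [u _ ->]].
      have /cards1P[u ->] : #|N| == 1%N by lia.
      by exists u.
    by rewrite cards1.
  rewrite big_imset /= => [|u v _ _]; last exact: set1_inj.
  rewrite (eq_bigr (fun u => V0 * mu2 * tilt eta X u)); last first.
    by move=> u _; rewrite cards1 big_set1 /=; ring.
  rewrite (eq_bigl xpredT) => [|u]; last by rewrite inE.
  by rewrite -mulr_sumr mulrC ler_wpM2r // mulr_ge0.
apply: (@le_trans _ _ ((\sum_u g u) ^+ 2)); last first.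
  rewrite sg mulrC; apply: lerXn2r; rewrite ?nnegrE ?mulr_ge0 //; first exact: le_trans st.
  by rewrite ler_wpM2r.
apply: le_trans hbig; rewrite le_eqVlt; apply/orP; left; apply/eqP; apply: eq_big => [N | N /andP[_ n1]].
  by rewrite -cards_eq0; case: #|N| => [|[|m]].
rewrite ifF; last by lia.
by rewrite big_split /= prodr_const exprMn; ring.
Qed.

End StarSum.

(** * Recursive construction of the coefficients and their cost *)

Section Certificate.
Variables (R : realFieldType) (n k : nat).
Hypothesis k_gt0 : (0 < k)%N.
Notation lab := {ffun 'I_n -> 'I_k}.
Variables (W : 'I_k -> 'I_k -> R) (kap mu V G eta : R) (L : nat).
Hypothesis W_sym : forall a b, W a b = W b a.
Hypothesis W_mean0 : forall a, \sum_b W a b = 0.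
Hypothesis W_bound : forall a b, `|W a b| <= kap.
Hypothesis W_mean_abs : forall b, k%:R^-1 * \sum_a `|W a b| <= mu.
Hypothesis kap_ge0 : 0 <= kap.
Hypothesis V_ge0 : 0 <= V.
Hypothesis G_gt0 : 0 < G.
Hypothesis L_le : L.*2%:R <= G.
Hypothesis eta_gt0 : 0 < eta.
Hypothesis eta_le1 : eta <= 1.
Let t : R := n%:R * eta + L%:R / eta.
Hypothesis t_le : t * (4 * V * (G * kap) ^+ 2) <= 1.
Hypothesis step_le : t * (4 * V * mu ^+ 2) + (t * (4 * V * (G * kap) ^+ 2)) ^+ 2 <= eta.
Implicit Types (S T : {set 'I_n * 'I_n}) (x : lab) (A D N : {set 'I_n}).

Notation up := (upper_pairs n).

(* Each vertex is processed at most once and then joins [D]; the Cauchy-Schwarz loss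
   of a factor 2 per edge at a processed vertex is stored in this weight. *)
Definition edge_cost D (p : 'I_n * 'I_n) : R := V * 2 ^+ ((p.1 \in D) + (p.2 \in D)).

Lemma edge_cost_ge0 D p : 0 <= edge_cost D p.
Proof. by rewrite mulr_ge0 // exprn_ge0. Qed.

Lemma edge_cost_le D p : edge_cost D p <= 4 * V.
Proof.
by rewrite /edge_cost mulrC ler_wpM2r //; case: (_ \in D); case: (_ \in D) => /=;
  rewrite ?expr0 ?expr1 ?expr2; lra.
Qed.

Lemma edge_cost_sub D D' p : D \subset D' -> edge_cost D p <= edge_cost D' p.
Proof.
move=> /subsetP sD; rewrite ler_wpM2l //.
have h u : ((u \in D) <= (u \in D'))%N by case: (boolP (u \in D)) => // /sD ->.
by apply: ler_weXn2l; [lra | apply: leq_add].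
Qed.

Lemma edge_cost_add i D T : i \notin D -> T \subset up ->
  \prod_(p in T) edge_cost (i |: D) p = 2 ^+ #|nb i T| * \prod_(p in T) edge_cost D p.
Proof.
move=> iD sT; rewrite [LHS](prod_star_rest i) // [X in _ = _ * X](prod_star_rest i) // mulrA; congr (_ * _); last first.
  apply: eq_bigr => p; rewrite inE => /and3P[_ /negPf h1 /negPf h2].
  by rewrite /edge_cost !inE h1 h2.
rewrite -prodr_const -big_split /=; apply: eq_bigr => u uT.
have ui : u != i by apply: contraTneq uT => ->; apply: nb_center.
by rewrite /edge; case: ifP => _; rewrite /edge_cost /= !inE eqxx (negPf ui) (negPf iD) /=;
  rewrite !exprD expr0 expr1; ring.
Qed.

(** For empty [D] this bounds E h^2, where h = sum_T a_T psi_T, as soon as [V] dominates the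
    variances 1 / (theta_p (1 - theta_p)) of the factors of psi_T. *)
Definition cost D (a : {set 'I_n * 'I_n} -> lab -> R) : R :=
  \sum_(T : {set 'I_n * 'I_n} | T \subset up)
    (\prod_(p in T) edge_cost D p) * label_mean (fun x => a T x ^+ 2).

(** The condition E[h phi_S] = E[F phi_S] for the centred monomials phi_S = prod_(p in S) (Y_p - c)
    of degree at most [l], after averaging over the graph given the labels. *)
Definition represents l (a : {set 'I_n * 'I_n} -> lab -> R) (F : lab -> R) :=
  forall S, S \subset up -> (#|S| <= l)%N ->
  \sum_(T : {set 'I_n * 'I_n} | T \subset S) label_mean (fun x => a T x * edge_weight W (S :\: T) x)
  = label_mean (fun x => F x * edge_weight W S x).

Section Step.
Variables (i : 'I_n) (l : nat) (aN : {set 'I_n} -> {set 'I_n * 'I_n} -> lab -> R).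

Definition admissible N := [&& N != set0, (#|N| <= l)%N & i \notin N].

(** One exploration step: every [N] whose star at [i] lies in [T] contributes the coefficient built
    for the cumulant along [N], at the remaining edges. *)
Definition glue T x : R :=
  \sum_(N | admissible N && (star i N \subset T)) aN N (T :\: star i N) x.

Lemma represents_glue F : (forall x, cond_mean i F x = 0) ->
  (forall N, admissible N -> represents (l - #|N|) (aN N) (cumulant W i F N)) ->
  represents l glue F.
Proof.
move=> F0 hN S sS cS.
have iS := nb_center i sS.
transitivity (\sum_(N | admissible N && (star i N \subset S))
   \sum_(T : {set 'I_n * 'I_n} | T \subset S :\: star i N)
     label_mean (fun x => aN N T x * edge_weight W ((S :\: star i N) :\: T) x)).
  transitivity (\sum_(T : {set 'I_n * 'I_n} | T \subset S)
     \sum_(N | admissible N && (star i N \subset T))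
     label_mean (fun x => aN N (T :\: star i N) x * edge_weight W (S :\: T) x)).
    apply: eq_bigr => T _; rewrite -label_mean_sum; apply: eq_label_mean => x.
    by rewrite /glue mulr_suml.
  rewrite (exchange_big_dep (fun N => admissible N && (star i N \subset S))) /=; last first.
    by move=> T N sT /andP[-> sN]; rewrite (subset_trans sN).
  apply: eq_bigr => N /andP[aN' sN].
  rewrite (eq_bigl (fun T => (star i N \subset T) && (T \subset S))); last first.
    by move=> T; rewrite aN' andbC.
  rewrite (sum_subset_addl (fun T => label_mean (fun x => aN N (T :\: star i N) x * edge_weight W (S :\: T) x))) //.
  apply: eq_bigr => T sT; apply: eq_label_mean => x.
  have dT : [disjoint T & star i N] by move: sT; rewrite subsetD => /andP[].
  by rewrite setDUl setDv set0U (setDidPl dT) setDDl.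
transitivity (\sum_(N | admissible N && (star i N \subset S))
   label_mean (fun x => cumulant W i F N x * edge_weight W (S :\: star i N) x)).
  apply: eq_bigr => N /andP[aN' sN]; apply: hN => //.
    by apply: subset_trans sS; apply: subsetDl.
  by rewrite cardsD (setIidPr sN) card_star; apply: leq_sub2r.
transitivity (\sum_(N : {set 'I_n} | N \subset nb i S) label_mean (fun x =>
   cumulant W i F N x * star_moment W i (nb i S :\: N) x * edge_weight W (rest i S) x)).
  (* The empty neighbourhood, excluded by [admissible], can be restored because its cumulant
     vanishes. *)
  rewrite [RHS](bigD1 set0) ?sub0set //=.
  rewrite [X in _ = X + _](_ : _ = 0); last first.
    rewrite -[RHS](label_mean_cst n k_gt0 0); apply: eq_label_mean => x.
    by rewrite cumulant0 // !mul0r.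
  rewrite add0r; apply: eq_big => [N | N /andP[aN' sN]].
    rewrite star_sub /admissible; case: (boolP (N \subset nb i S)) => sN; rewrite ?andbF //= !andbT.
    have -> : i \notin N by apply: contra iS; apply/subsetP.
    suff -> : (#|N| <= l)%N by rewrite !andbT.
    by rewrite (leq_trans _ cS) // -(card_star i) subset_leq_card // star_sub.
  rewrite -(label_mean_cond k_gt0 i); apply: eq_label_mean => x.
  rewrite (@eq_cond_mean _ _ _ _ _ (fun x => cumulant W i F N x *
    (star_weight W i (nb i S :\: N) x * edge_weight W (rest i S) x))).
    rewrite cond_meanMl; last exact: indep_cumulant_center.
    rewrite cond_meanMr; last exact: indep_edge_weight_rest.
    by rewrite mulrA.
  move=> y; rewrite (edge_weight_star W_sym i) ?nb_setD_star ?rest_setD_star //.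
  by apply: subset_trans sS; apply: subsetDl.
rewrite -label_mean_sum.
transitivity (label_mean (fun x => target_moment W i F (nb i S) x * edge_weight W (rest i S) x)).
  by apply: eq_label_mean => x; rewrite -mulr_suml sum_cumulant.
rewrite -[RHS](label_mean_cond k_gt0 i); apply: eq_label_mean => x.
rewrite -(cond_meanMr _ (indep_edge_weight_rest W i S)).
by apply: eq_cond_mean => y; rewrite (edge_weight_star W_sym i y sS) mulrA.
Qed.

(** Cauchy-Schwarz over the stars contained in [T]; the loss is absorbed by moving [i] into [D], and
    the edges of the removed star are paid for by powers of [4 * V]. *)
Lemma cost_glue D : i \notin D ->
  cost D glue <= \sum_(N | admissible N) (4 * V) ^+ #|N| * cost (i |: D) (aN N).
Proof.
move=> iD.
pose h N T := (\prod_(p in T) edge_cost (i |: D) p) *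
  label_mean (fun x => aN N (T :\: star i N) x ^+ 2).
have cost_prod_ge0 D' T : 0 <= \prod_(p in T) edge_cost D' p.
  by apply: prodr_ge0 => p _; apply: edge_cost_ge0.
apply: (@le_trans _ _ (\sum_(T : {set 'I_n * 'I_n} | T \subset up)
   \sum_(N | admissible N && (star i N \subset T)) h N T)).
  apply: ler_sum => T sT; rewrite -mulr_sumr edge_cost_add // -mulrA mulrCA.
  apply: ler_wpM2l; first exact: cost_prod_ge0.
  rewrite -label_mean_sum -label_meanZ; apply: label_mean_le => x.
  apply: (le_trans (sqr_sum_le _ _)); apply: ler_wpM2r.
    by apply: sumr_ge0 => N _; apply: sqr_ge0.
  (* The stars at [i] inside [T] correspond to subsets of [nb i T]; their number is at most the
     power of 2 supplied by [edge_cost_add]. *)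
  rewrite -natrX ler_nat -card_powerset; apply: subset_leq_card; apply/subsetP => N /andP[_].
  by rewrite star_sub powersetE.
rewrite (exchange_big_dep admissible) /=; last by move=> T N _ /andP[].
apply: ler_sum => N aN'; have iN : i \notin N by case/and3P: aN'.
rewrite (eq_bigl (fun T => (star i N \subset T) && (T \subset up))); last first.
  by move=> T; rewrite aN' andbC.
rewrite (sum_subset_addl (h N)) ?star_upper // /cost mulr_sumr.
apply: (@le_trans _ _ (\sum_(T : {set 'I_n * 'I_n} | T \subset up :\: star i N)
    (4 * V) ^+ #|N| * ((\prod_(p in T) edge_cost (i |: D) p) *
      label_mean (fun x => aN N T x ^+ 2)))); last first.
  (* Sets [T] meeting the star only add nonnegative terms to the cost. *)
  rewrite [leRHS](bigID (fun T => T \subset up :\: star i N)) /=.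
  rewrite [X in _ <= X + _](eq_bigl (fun T => T \subset up :\: star i N)); last first.
    by move=> T; rewrite subsetD; case: (T \subset up).
  rewrite lerDl; apply: sumr_ge0 => T _; rewrite !mulr_ge0 ?exprn_ge0 ?mulr_ge0 //.
  by apply: label_mean_ge0 => x; apply: sqr_ge0.
apply: ler_sum => T; rewrite subsetD => /andP[sT dT]; rewrite /h.
rewrite setDUl setDv set0U (setDidPl dT) mulrA; apply: ler_wpM2r.
  by apply: label_mean_ge0 => x; apply: sqr_ge0.
rewrite (eq_bigl _ _ (fun p => in_setU p _ _)) bigU /=; last by rewrite disjoint_sym.
apply: ler_wpM2r; first exact: cost_prod_ge0.
rewrite -(card_star i) -prodr_const; apply: ler_prod => p _.
by rewrite edge_cost_ge0 edge_cost_le.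
Qed.

End Step.

Lemma cost_sub D D' a : D \subset D' -> cost D a <= cost D' a.
Proof.
move=> sD; apply: ler_sum => T _; apply: ler_wpM2r.
  by apply: label_mean_ge0 => x; apply: sqr_ge0.
by apply: ler_prod => p _; rewrite edge_cost_ge0 edge_cost_sub.
Qed.

(* Exploring [N] from [i] turns the vertices of [N] outside [A :|: D] into active ones,
   while hitting [A :|: D] may deactivate a vertex: a gain, respectively a loss, of [eta]. *)
Lemma active_card A D N i : i \in A -> i \notin N ->
  eta * eta ^+ #|((A :\ i) :\: N) :|: (N :\: (A :|: D))| <=
  eta ^+ #|A| * \prod_(u in N) tilt eta (A :|: D) u.
Proof.
set X := A :|: D; move=> iA iN; rewrite prod_tilt cardsU.
rewrite [_ :&: _](_ : _ = set0) ?cards0 ?subn0; last first.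
  by apply/setP => u; rewrite !inE; case: (u \in N); rewrite ?andbF.
rewrite (cardsD1 i A) iA -(cardsID N (A :\ i)).
set c := #|_ :\: N|; set d := #|_ :&: N|; set a := #|N :&: X|; set b := #|N :\: X|.
have da : (d <= a)%N.
  by apply: subset_leq_card; apply/subsetP => u; rewrite !inE => /andP[/andP[_ ->] ->].
rewrite !exprD expr1 -!mulrA; apply: ler_wpM2l; first exact: ltW.
rewrite mulrCA; apply: ler_wpM2l; first by rewrite exprn_ge0 // ltW.
rewrite mulrA -[leLHS]mul1r; apply: ler_wpM2r; first by rewrite exprn_ge0 // ltW.
rewrite exprVn ler_pdivlMr ?exprn_gt0 // mul1r.
by apply: ler_wiXn2l => //; apply: ltW.
Qed.

(** Strong induction on [l]. The label function is centred at the active vertices [A], may depend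
    freely on the labels in [D], and ignores unvisited vertices. The bound by [L] limits how many
    vertices are ever visited. *)
Lemma certificate l A D F B :
  (l + #|A :|: D| <= L)%N -> [disjoint A & D] -> 0 <= B ->
  (forall x, `|F x| <= B) -> (forall u, u \in A -> forall x, cond_mean u F x = 0) ->
  (forall u, u \notin A :|: D -> indep u F) ->
  exists2 a, represents l a F & cost D a <= eta ^+ #|A| * B ^+ 2.
Proof.
have [m] := ubnP l; elim: m l A D F B => // m IH l A D F B lm hL dAD B0 Fb FA Findep.
have [-> | [i iA]] := set_0Vmem A.
  (* With no active vertex left, h is [F] itself and costs at most [B ^+ 2]. *)
  exists (fun T x => if T == set0 then F x else 0).
    move=> S sS _; rewrite (bigD1 set0) ?sub0set //= eqxx setD0 big1 ?addr0 // => T /andP[_ /negPf ->].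
    rewrite -[RHS](label_mean_cst n k_gt0 0); apply: eq_label_mean => x; by rewrite mul0r.
  rewrite /cost (bigD1 set0) ?sub0set //= eqxx big_set0 big1 => [|T /andP[_ /negPf ->]]; last first.
    rewrite (@eq_label_mean _ _ _ _ (fun=> 0)) ?label_mean_cst ?mulr0 // => x; by rewrite expr0n.
  rewrite addr0 cards0 expr0 !mul1r -[leRHS](label_mean_cst n k_gt0); apply: label_mean_le => x.
  by rewrite -real_normK ?num_real //; apply: lerXn2r; rewrite ?nnegrE.
have iD : i \notin D by rewrite (disjointFr dAD).
set X := A :|: D.
(* Still active are the old vertices that [N] misses and the new ones that it meets; [i] and the
   active vertices that are hit pass to [D' N]. *)
pose A' N := ((A :\ i) :\: N) :|: (N :\: X).
pose D' N := (i |: D) :|: (N :&: A).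
pose BN N := if #|N| == 1%N then B * mu else B * (G * kap) ^+ #|N|.
have mu_ge0 : 0 <= mu.
  have [b _] : exists b : 'I_k, true by exists (Ordinal k_gt0).
  apply: le_trans (W_mean_abs b); rewrite mulr_ge0 ?invr_ge0 //; exact: sumr_ge0.
have BN0 N : 0 <= BN N.
  by rewrite /BN; case: ifP => _; rewrite mulr_ge0 // exprn_ge0 // mulr_ge0 // ltW.
have /fin_all_exists [aN haN] N : exists a, admissible i l N ->
    represents (l - #|N|) a (cumulant W i F N) /\ cost (D' N) a <= eta ^+ #|A' N| * BN N ^+ 2.
  have [aN | _] := boolP (admissible i l N); last by exists (fun _ _ => 0).
  have /and3P[N0 Nl iN] := aN.
  have Npos : (0 < #|N|)%N by rewrite lt0n cards_eq0.
  have [|||||||a ha1 ha2] := IH (l - #|N|)%N (A' N) (D' N) (cumulant W i F N) (BN N).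
  - by rewrite (leq_trans _ (lm : (l <= m)%N)) // ltn_subrL Npos (leq_trans Npos Nl).
  - have sub : A' N :|: D' N \subset X :|: N.
      apply/subsetP => u; rewrite !inE; case: (eqVneq u i) => [-> | _] /=; first by rewrite iA.
      by case: (u \in A); case: (u \in D); case: (u \in N).
    apply: leq_trans hL; rewrite -[X in (_ <= X + _)%N](subnK Nl) -addnA leq_add2l.
    by rewrite (leq_trans (subset_leq_card sub)) // addnC leq_card_setU.
  - rewrite disjoint_subset; apply/subsetP => u; rewrite !inE.
    have := disjointFr dAD; move/(_ u).
    case: (eqVneq u i) => [-> | _] /=; first by rewrite iA (negPf iN).
    by case: (u \in A); case: (u \in D); case: (u \in N) => //= /(_ isT).
  - exact: BN0.
  - move=> x; rewrite /BN; case: ifPn => [/cards1P[u eN] | _].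
      have ui : u != i by apply: contraNneq iN => <-; rewrite eN inE.
      by rewrite eN; apply: (cumulant1_bound k_gt0 (FA i iA) W_mean_abs Fb B0).
    apply: cumulant_bound => //; first exact: FA.
    apply: le_trans L_le; rewrite ler_nat leq_double.
    by rewrite (leq_trans Nl) // (leq_trans _ hL) // leq_addr.
  - move=> u; rewrite !inE => /orP[/and3P[uN ui uA] | /andP[uX uN]].
      exact: cond_mean_cumulant_out (FA u uA).
    have ui : u != i by apply: contraNneq iN => <-.
    by apply: cond_mean_cumulant_in => //; apply: Findep; rewrite inE.
  - move=> u hu; have [ui uN uX] : [/\ u != i, u \notin N & u \notin X].
      move: hu; rewrite !inE; case: (eqVneq u i) => /= _; first by rewrite !orbT.
      by case: (u \in A); case: (u \in D); case: (u \in N).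
    exact: (indep_cumulant k_gt0 W ui uN (Findep u uX)).
  by exists a => _; split.
exists (glue i l aN).
  apply: represents_glue; first exact: FA.
  by move=> N /haN [].
apply: (le_trans (cost_glue _ _ iD)).
have XL : (#|X| <= L)%N by apply: leq_trans hL; apply: leq_addl.
have V40 : 0 <= 4 * V by rewrite mulr_ge0.
(* The additional factor [eta] is the one in [active_card]; on the right it matches the bound [eta]
   of [star_sum_le]. *)
rewrite -(ler_pM2l eta_gt0) mulr_sumr.
pose c N := if #|N| == 1%N then mu ^+ 2 else ((G * kap) ^+ 2) ^+ #|N|.
have c0 N : 0 <= c N.
  by rewrite /c; case: ifP => _; rewrite ?exprn_ge0 // mulr_ge0 // ltW.
apply: (@le_trans _ _ (\sum_(N : {set 'I_n} | N != set0) (eta ^+ #|A| * B ^+ 2) *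
    ((4 * V) ^+ #|N| * (\prod_(u in N) tilt eta X u) * c N))); last first.
  rewrite -mulr_sumr [leRHS]mulrC; apply: ler_wpM2l.
    by rewrite mulr_ge0 ?exprn_ge0 // ltW.
  by apply: (@star_sum_le _ _ _ _ _ _ L); rewrite ?card_ord ?exprn_ge0 // mulr_ge0 // ltW.
rewrite [leLHS]big_mkcond [leRHS]big_mkcond /=; apply: ler_sum => N _.
have tilt_prod0 : 0 <= \prod_(u in N) tilt eta X u.
  by apply: prodr_ge0 => u _; rewrite /tilt; case: ifP => _; rewrite ?invr_ge0 ltW.
have [aN' | _] := boolP (admissible i l N); last first.
  by case: ifP => // _; rewrite !mulr_ge0 ?exprn_ge0 // ltW.
have /and3P[N0 Nl iN] := aN'; rewrite N0.
have [_ hc] := haN N aN'.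
have hc' : cost (i |: D) (aN N) <= eta ^+ #|A' N| * BN N ^+ 2.
  by apply: le_trans hc; apply: cost_sub; apply: subsetUl.
have BNE : BN N ^+ 2 = B ^+ 2 * c N.
  by rewrite /BN /c; case: ifP => _; rewrite exprMn // exprAC.
rewrite mulrCA; apply: (@le_trans _ _ ((4 * V) ^+ #|N| *
    (eta * eta ^+ #|A' N| * (B ^+ 2 * c N)))).
  by rewrite -[eta * _ * _]mulrA -BNE; apply: ler_wpM2l; rewrite ?exprn_ge0 // ler_wpM2l // ltW.
rewrite [leRHS](_ : _ = (4 * V) ^+ #|N| * (eta ^+ #|A| * \prod_(u in N) tilt eta X u * (B ^+ 2 * c N))); last by ring.
apply: ler_wpM2l; first by rewrite exprn_ge0.
by apply: ler_wpM2r; [rewrite mulr_ge0 ?exprn_ge0 | apply: active_card].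
Qed.

End Certificate.

(** * Independent edges and the orthogonal basis given the labels *)

Section BernoulliGraph.
Variables (R : realFieldType) (n : nat) (th : 'I_n * 'I_n -> R).
Hypothesis th_gt0 : forall p, 0 < th p.
Hypothesis th_lt1 : forall p, th p < 1.
Implicit Types (S T E : {set 'I_n * 'I_n}) (g : {set 'I_n * 'I_n} -> R).

Notation up := (upper_pairs n).

Definition graph_law E : R := \prod_(p in up) (if p \in E then th p else 1 - th p).

Definition graph_mean g : R :=
  \sum_(E : {set 'I_n * 'I_n} | E \subset up) graph_law E * g E.

Lemma graph_mean_prod (f : 'I_n * 'I_n -> bool -> R) :
  graph_mean (fun E => \prod_(p in up) f p (p \in E)) =
  \prod_(p in up) (th p * f p true + (1 - th p) * f p false).
Proof.
rewrite prod_add_subset; apply: eq_bigr => E sE; rewrite -big_split /= (big_setID E) /=.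
rewrite (setIidPr sE); congr (_ * _); apply: eq_bigr => p; first by move=> ->.
by rewrite inE => /andP[/negPf ->].
Qed.

Lemma graph_mean_sum (I : Type) (r : seq I) (J : pred I) (f : I -> {set 'I_n * 'I_n} -> R) :
  graph_mean (fun E => \sum_(a <- r | J a) f a E) = \sum_(a <- r | J a) graph_mean (f a).
Proof. by rewrite exchange_big; apply: eq_bigr => E _; rewrite mulr_sumr. Qed.

Lemma graph_meanZ c g : graph_mean (fun E => c * g E) = c * graph_mean g.
Proof. by rewrite mulr_sumr; apply: eq_bigr => E _; rewrite mulrCA. Qed.

Lemma eq_graph_mean g g' : (forall E, E \subset up -> g E = g' E) -> graph_mean g = graph_mean g'.
Proof. by move=> e; apply: eq_bigr => E sE; rewrite e. Qed.

Lemma graph_law_ge0 E : 0 <= graph_law E.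
Proof. by apply: prodr_ge0 => p _; case: ifP => _; rewrite ?subr_ge0 ltW. Qed.

Lemma graph_mean_ge0 g : (forall E, 0 <= g E) -> 0 <= graph_mean g.
Proof. by move=> g0; apply: sumr_ge0 => E _; rewrite mulr_ge0 // graph_law_ge0. Qed.

Lemma graph_mean_cst c : graph_mean (fun=> c) = c.
Proof.
have := graph_mean_prod (fun _ _ => 1).
rewrite [RHS]big1 => [|p _]; last by ring.
rewrite (eq_graph_mean (g' := fun=> 1)) => [h | E _]; last by rewrite big1.
by have := graph_meanZ c (fun=> 1); rewrite h mulr1.
Qed.

Definition centered (c : R) S E : R := \prod_(p in S) ((p \in E)%:R - c).

(** Scaled by the variance and not by its root, so that each factor has mean product 1 with the
    indicator of the same edge shifted by any constant. *)
Definition normalized T E : R :=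
  \prod_(p in T) (((p \in E)%:R - th p) / (th p * (1 - th p))).

Lemma prod_extend (f : 'I_n * 'I_n -> R) S : S \subset up ->
  \prod_(p in S) f p = \prod_(p in up) (if p \in S then f p else 1).
Proof.
move=> sS; rewrite -big_mkcondr /=; apply: eq_bigl => p.
by case: (boolP (p \in S)) => [/(subsetP sS) -> | _]; rewrite ?andbF.
Qed.

Let var_neq0 p : th p != 0 /\ 1 - th p != 0.
Proof. by rewrite !gt_eqF ?subr_gt0. Qed.

(** Edge by edge, the mean is 1 on the common edges, [th p - c] on [S] alone and 0 on [T] alone. *)
Lemma graph_mean_normalized_centered c S T : S \subset up -> T \subset up ->
  graph_mean (fun E => normalized T E * centered c S E) =
  if T \subset S then \prod_(p in S :\: T) (th p - c) else 0.
Proof.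
move=> sS sT.
pose f p (b : bool) : R := (if p \in T then (b%:R - th p) / (th p * (1 - th p)) else 1) *
  (if p \in S then b%:R - c else 1).
rewrite (@eq_graph_mean _ (fun E => \prod_(p in up) f p (p \in E))); last first.
  by move=> E _; rewrite /normalized /centered (prod_extend _ sT) (prod_extend _ sS) -big_split.
rewrite graph_mean_prod /f; case: ifPn => [sTS | /subsetPn [p pT pS]].
  rewrite (@prod_extend (fun p => th p - c)); last by apply: subset_trans sS; apply: subsetDl.
  apply: eq_bigr => p _; have [h1 h2] := var_neq0 p; rewrite inE.
  case: (boolP (p \in T)) => pT /=; first by rewrite (subsetP sTS) //=; field; apply/andP.
  by case: ifP => _; rewrite /=; ring.
have [h1 h2] := var_neq0 p.
rewrite (bigD1 p) ?(subsetP sT) //= pT (negPf pS).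
by rewrite [X in X * _](_ : _ = 0) ?mul0r //; field; apply/andP.
Qed.

Lemma graph_mean_normalized2 T T' : T \subset up -> T' \subset up ->
  graph_mean (fun E => normalized T E * normalized T' E) =
  if T == T' then \prod_(p in T) (th p * (1 - th p))^-1 else 0.
Proof.
move=> sT sT'.
pose f p (b : bool) : R := (if p \in T then (b%:R - th p) / (th p * (1 - th p)) else 1) *
  (if p \in T' then (b%:R - th p) / (th p * (1 - th p)) else 1).
rewrite (@eq_graph_mean _ (fun E => \prod_(p in up) f p (p \in E))); last first.
  by move=> E _; rewrite /normalized (prod_extend _ sT) (prod_extend _ sT') -big_split.
rewrite graph_mean_prod /f; case: eqVneq => [<- | /eqP neq].
  rewrite (prod_extend _ sT); apply: eq_bigr => p _; have [h1 h2] := var_neq0 p.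
  by case: ifP => _ /=; [field; apply/andP | ring].
have [p pd] : exists p, (p \in T) != (p \in T').
  by apply/existsP; apply: contra_notT neq => /existsPn h; apply/setP => p; apply/eqP/negbNE/h.
have pup : p \in up.
  by move: pd; case: (boolP (p \in T)) => [/(subsetP sT) // | _]; case: (boolP (p \in T')) => // /(subsetP sT').
rewrite (bigD1 p) //= [X in X * _](_ : _ = 0) ?mul0r //.
have [h1 h2] := var_neq0 p.
by move: pd; case: (p \in T); case: (p \in T') => //= _; field; apply/andP.
Qed.

Lemma graph_mean_sqr (a : {set 'I_n * 'I_n} -> R) :
  graph_mean (fun E => (\sum_(T : {set 'I_n * 'I_n} | T \subset up) a T * normalized T E) ^+ 2) =
  \sum_(T : {set 'I_n * 'I_n} | T \subset up) a T ^+ 2 * \prod_(p in T) (th p * (1 - th p))^-1.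
Proof.
transitivity (\sum_(T : {set 'I_n * 'I_n} | T \subset up)
    \sum_(T' : {set 'I_n * 'I_n} | T' \subset up)
   a T * a T' * graph_mean (fun E => normalized T E * normalized T' E)).
  rewrite -(eq_graph_mean (g := fun E => \sum_(T : {set 'I_n * 'I_n} | T \subset up)
    \sum_(T' : {set 'I_n * 'I_n} | T' \subset up) a T * a T' * (normalized T E * normalized T' E))).
    rewrite graph_mean_sum; apply: eq_bigr => T _; rewrite graph_mean_sum.
    by apply: eq_bigr => T' _; rewrite graph_meanZ.
  move=> E _; rewrite expr2 mulr_suml; apply: eq_bigr => T _; rewrite mulr_sumr.
  by apply: eq_bigr => T' _; ring.
apply: eq_bigr => T sT; rewrite (bigD1 T) //= graph_mean_normalized2 // eqxx [X in _ + X]big1 ?addr0 ?expr2 //.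
by move=> T' /andP[sT' /negPf nT]; rewrite graph_mean_normalized2 // eq_sym nT mulr0.
Qed.

End BernoulliGraph.

(** * Lower bound on the risk from a system of coefficients *)

Section Correlation.
Variables (R : realFieldType) (n k : nat).
Hypothesis k_gt0 : (0 < k)%N.
Notation lab := {ffun 'I_n -> 'I_k}.
Notation up := (upper_pairs n).
Variables (W : 'I_k -> 'I_k -> R) (c V : R).
Implicit Types (S T E : {set 'I_n * 'I_n}) (x : lab) (g : {set 'I_n * 'I_n} -> R).

Definition edge_prob x (p : 'I_n * 'I_n) : R := c + W (x p.1) (x p.2).

Definition spanned (l : nat) g := exists b : {set 'I_n * 'I_n} -> R, forall E, E \subset up ->
  g E = \sum_(S : {set 'I_n * 'I_n} | (S \subset up) && (#|S| <= l)%N) b S * centered c S E.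

Hypothesis prob_gt0 : forall x p, 0 < edge_prob x p.
Hypothesis prob_lt1 : forall x p, edge_prob x p < 1.
Hypothesis V_ge : forall x p, (edge_prob x p * (1 - edge_prob x p))^-1 <= V.

Lemma graph_mean_centered x S : S \subset up ->
  graph_mean (edge_prob x) (centered c S) = edge_weight W S x.
Proof.
move=> sS.
have := graph_mean_normalized_centered (prob_gt0 x) (prob_lt1 x) c sS (sub0set _).
rewrite sub0set setD0 => h; rewrite -(eq_graph_mean _ (g := fun E => normalized (edge_prob x) set0 E * centered c S E)).
  by rewrite h; apply: eq_bigr => p _; rewrite /edge_prob addrC addKr.
by move=> E _; rewrite /normalized big_set0 mul1r.
Qed.

(** Nonnegativity of E(g - h)^2 for h = sum_T a_T psi_T, together with E[h g] = E[F g] and the bound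
    of E h^2 by the cost. *)
Lemma correlation_bound l a (F : lab -> R) g :
  represents W l a F -> spanned l g ->
  label_mean (fun x => F x ^+ 2) - cost V set0 a <=
  label_mean (fun x => graph_mean (edge_prob x) (fun E => (g E - F x) ^+ 2)).
Proof.
move=> ha [b hb].
pose G1 x := \sum_(S : {set 'I_n * 'I_n} | (S \subset up) && (#|S| <= l)%N)
  b S * \sum_(T : {set 'I_n * 'I_n} | T \subset S) a T x * edge_weight W (S :\: T) x.
pose G2 x := \sum_(S : {set 'I_n * 'I_n} | (S \subset up) && (#|S| <= l)%N)
  b S * (F x * edge_weight W S x).
pose Q x := \sum_(T : {set 'I_n * 'I_n} | T \subset up) (\prod_(p in T) edge_cost V set0 p) * a T x ^+ 2.
have G12 : label_mean G1 = label_mean G2.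
  rewrite !label_mean_sum; apply: eq_bigr => S /andP[sS cS]; rewrite !label_meanZ.
  by rewrite label_mean_sum ha.
have meanQ : label_mean Q = cost V set0 a.
  by rewrite label_mean_sum; apply: eq_bigr => T _; rewrite label_meanZ.
pose h x E := \sum_(T : {set 'I_n * 'I_n} | T \subset up) a T x * normalized (edge_prob x) T E.
have hQ x : graph_mean (edge_prob x) (fun E => h x E ^+ 2) <= Q x.
  rewrite graph_mean_sqr //; apply: ler_sum => T _; rewrite mulrC ler_wpM2r ?sqr_ge0 //.
  apply: ler_prod => p _; rewrite /edge_cost !inE expr0 mulr1 V_ge andbT.
  by rewrite invr_ge0 mulr_ge0 ?subr_ge0 ?ltW.
have hG1 x : graph_mean (edge_prob x) (fun E => h x E * g E) = G1 x.
  rewrite (eq_graph_mean _ (g' := fun E =>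
     \sum_(S : {set 'I_n * 'I_n} | (S \subset up) && (#|S| <= l)%N)
     \sum_(T : {set 'I_n * 'I_n} | T \subset up) b S * a T x *
       (normalized (edge_prob x) T E * centered c S E))).
    rewrite graph_mean_sum; apply: eq_bigr => S /andP[sS cS].
    rewrite graph_mean_sum mulr_sumr [LHS](bigID (fun T => T \subset S)) /=.
    rewrite [X in _ + X]big1 ?addr0; last first.
      move=> T /andP[sT /negPf nT].
      by rewrite graph_meanZ graph_mean_normalized_centered // nT mulr0.
    apply: eq_big => [T | T /andP[sT sTS]].
      by case: (boolP (T \subset S)) => sTS; rewrite ?andbF // (subset_trans sTS).
    rewrite graph_meanZ graph_mean_normalized_centered // sTS -mulrA; congr (_ * (_ * _)).
    by apply: eq_bigr => p _; rewrite /edge_prob addrC addKr.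
  move=> E sE; rewrite hb // mulr_sumr; apply: eq_bigr => S _; rewrite mulr_suml.
  by apply: eq_bigr => T _; ring.
have hG2 x : graph_mean (edge_prob x) (fun E => F x * g E) = G2 x.
  rewrite (eq_graph_mean _ (g' := fun E =>
     \sum_(S : {set 'I_n * 'I_n} | (S \subset up) && (#|S| <= l)%N) b S * F x * centered c S E)).
    rewrite graph_mean_sum; apply: eq_bigr => S /andP[sS cS].
    by rewrite graph_meanZ graph_mean_centered // mulrA.
  by move=> E sE; rewrite hb // mulr_sumr; apply: eq_bigr => S _; ring.
(* Adding 2 (G1 - G2), which has mean zero, makes the inequality true for each labelling
   separately. *)
have -> : label_mean (fun x => F x ^+ 2) - cost V set0 a =
   label_mean (fun x => 2 * G1 x - 2 * G2 x + F x ^+ 2 - Q x).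
  transitivity (2 * label_mean G1 - 2 * label_mean G2 + label_mean (fun x => F x ^+ 2) - label_mean Q).
    by rewrite G12 subrr add0r meanQ.
  rewrite /label_mean !mulr_sumr -!sumrN -!big_split /=; apply: eq_bigr => x _; ring.
apply: label_mean_le => x.
have := hQ x; rewrite -hG1 -hG2 => {}hQ.
suff : graph_mean (edge_prob x) (fun E => (g E - F x) ^+ 2) -
   (2 * graph_mean (edge_prob x) (fun E => h x E * g E) -
    2 * graph_mean (edge_prob x) (fun E => F x * g E) + F x ^+ 2 -
    graph_mean (edge_prob x) (fun E => h x E ^+ 2)) >= 0 by lra.
have -> : F x ^+ 2 = graph_mean (edge_prob x) (fun=> F x ^+ 2) by rewrite graph_mean_cst.
have -> : graph_mean (edge_prob x) (fun E => (g E - F x) ^+ 2) -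
   (2 * graph_mean (edge_prob x) (fun E => h x E * g E) -
    2 * graph_mean (edge_prob x) (fun E => F x * g E) + graph_mean (edge_prob x) (fun=> F x ^+ 2) -
    graph_mean (edge_prob x) (fun E => h x E ^+ 2)) =
   graph_mean (edge_prob x) (fun E => (g E - h x E) ^+ 2).
  rewrite /graph_mean !mulr_sumr -!sumrN -!big_split /= -sumrN -big_split /=.
  by apply: eq_bigr => E _; ring.
by apply: graph_mean_ge0 => // E; apply: sqr_ge0.
Qed.

End Correlation.

(** * Polynomials in the adjacency matrix as combinations of centred edge monomials *)

Section PolynomialsInGraph.
Variables (R : realType) (n : nat) (c : R).
Notation up := (upper_pairs n).
Implicit Types (S T E : {set 'I_n * 'I_n}) (g : {set 'I_n * 'I_n} -> R) (l : nat).

Lemma prod_indicator (I : finType) (A : pred I) (P : pred I) :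
  \prod_(i | A i) (P i)%:R = [forall i, A i ==> P i]%:R :> R.
Proof.
case: (boolP [forall i, A i ==> P i]) => [/forallP h | /forallPn [i]].
  by rewrite big1 // => i Ai; have := h i; rewrite Ai /= => ->.
by rewrite negb_imply => /andP[Ai /negPf nP]; rewrite (bigD1 i) //= nP mul0r.
Qed.

Lemma spanned_lin l g g' e : spanned c l g -> spanned c l g' -> spanned c l (fun E => e * g E + g' E).
Proof.
move=> [b hb] [b' hb']; exists (fun S => e * b S + b' S) => E sE.
rewrite hb // hb' // mulr_sumr -big_split /=; apply: eq_bigr => S _; ring.
Qed.

Lemma spanned0 l : spanned c l (fun E : {set 'I_n * 'I_n} => 0).
Proof. by exists (fun=> 0) => E _; rewrite big1 // => S _; rewrite mul0r. Qed.

Lemma eq_spanned l g g' : (forall E, E \subset up -> g E = g' E) -> spanned c l g -> spanned c l g'.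
Proof. by move=> e [b hb]; exists b => E sE; rewrite -e // hb. Qed.

Lemma spanned_sum l (I : eqType) (r : seq I) (e : I -> R) (h : I -> {set 'I_n * 'I_n} -> R) :
  (forall i, i \in r -> spanned c l (h i)) -> spanned c l (fun E => \sum_(i <- r) e i * h i E).
Proof.
elim: r => [|i r IH] hr.
  by apply: eq_spanned (spanned0 l) => E _; rewrite big_nil.
have h1 := hr i (mem_head _ _).
have h2 := IH (fun j jr => hr j (mem_behead (s := i :: r) jr)).
by apply: eq_spanned (spanned_lin (e i) h1 h2) => E _; rewrite big_cons.
Qed.

Lemma spanned_edges l S : S \subset up -> (#|S| <= l)%N ->
  spanned c l (fun E => \prod_(p in S) (p \in E)%:R).
Proof.
move=> sS cS; exists (fun T => if T \subset S then c ^+ #|S :\: T| else 0) => E _.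
transitivity (\prod_(p in S) (((p \in E)%:R - c) + c)).
  by apply: eq_bigr => p _; rewrite subrK.
rewrite prod_add_subset [LHS]big_mkcond [RHS]big_mkcond /=; apply: eq_bigr => T _.
case: (boolP (T \subset S)) => sTS; last by case: ifP; rewrite ?mul0r.
rewrite (subset_trans sTS sS) (leq_trans (subset_leq_card sTS) cS) /=.
by rewrite prodr_const mulrC.
Qed.

Lemma adjacency_edge E (a b : 'I_n) : E \subset up -> a != b ->
  adjacency R E a b = (edge a b \in E)%:R.
Proof.
move=> /subsetP sE ab; rewrite mxE /edge.
have nE (u v : 'I_n) : (u <= v)%N -> (v, u) \in E = false.
  by move=> uv; apply/negP => /sE; rewrite inE /= ltnNge uv.
have ab' : (a : nat) != b by [].
by case: (ltngtP a b) ab' => // h _; rewrite (nE _ _ (ltnW h)) ?orbF /=; case: ifP.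
Qed.

Lemma adjacency_diag E (a : 'I_n) : E \subset up -> adjacency R E a a = 0.
Proof.
by move=> /subsetP sE; rewrite mxE orbb ifF //; apply/negP => /sE; rewrite inE /= ltnn.
Qed.

(** Entries are 0 or 1 and the diagonal is zero, so a monomial is either zero or the indicator that
    certain edges are present, no more of them than its degree. *)
Lemma spanned_mpoly l (Q : {mpoly R[n * n]}) : (msize Q <= l.+1)%N ->
  spanned c l (fun E => Q.@[fun m => mxvec (adjacency R E) 0 m]).
Proof.
move=> hQ.
apply: eq_spanned (spanned_sum (r := msupp Q) (fun m => Q@_m)
   (h := fun m E => \prod_i (mxvec (adjacency R E) 0 i) ^+ m i) _) => [E _|m mQ].
  by rewrite mevalE.
have hm : (mdeg m <= l)%N by have := msize_mdeg_lt mQ; move/leq_trans/(_ hQ).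
have /fin_all_exists [e he] : forall i : 'I_(n * n), exists ab : 'I_n * 'I_n, i = mxvec_index ab.1 ab.2.
  by case/mxvec_indexP => a b; exists (a, b).
case: (boolP [exists i, (m i != 0%N) && ((e i).1 == (e i).2)]) => [/existsP [i /andP[mi /eqP ei]] | /existsPn nd].
  apply: eq_spanned (spanned0 l) => E sE.
  by rewrite (bigD1 i) //= {1}(he i) mxvecE ei adjacency_diag // expr0n (negPf mi) mul0r.
pose I := [set i | m i != 0%N].
have nI i : i \in I -> (e i).1 != (e i).2.
  by rewrite inE => mi; have := nd i; rewrite mi.
(* Powers collapse, and so do the two variables of one unordered pair; hence |S| is at most the
   degree. *)
pose S := [set edge (e i).1 (e i).2 | i in I].
have sS : S \subset up.
  by apply/subsetP => _ /imsetP[i iI ->]; apply: edge_upper; rewrite eq_sym nI.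
have cS : (#|S| <= l)%N.
  apply: leq_trans hm; apply: (leq_trans (leq_imset_card _ _)).
  rewrite mdegE -sum1_card big_mkcond /=; apply: leq_sum => i _.
  by rewrite inE; case: (m i).
apply: eq_spanned (spanned_edges sS cS) => E sE.
rewrite prod_indicator [RHS](bigID (mem I)) /= [X in _ * X]big1; last first.
  by move=> i; rewrite inE negbK => /eqP ->; rewrite expr0.
rewrite mulr1 (eq_bigr (fun i => (edge (e i).1 (e i).2 \in E)%:R)); last first.
  move=> i iI; rewrite {1}(he i) mxvecE adjacency_edge ?nI // -natrX.
  by congr (_%:R); case: (_ \in E); rewrite ?exp1n // exp0n // lt0n; move: iI; rewrite inE.
rewrite prod_indicator; congr ((nat_of_bool _)%:R); apply/forallP/forallP => h.
  by move=> i; apply/implyP => iI; apply: (implyP (h _)); apply: imset_f.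
by move=> p; apply/implyP => /imsetP[i iI ->]; apply: (implyP (h i)).
Qed.

End PolynomialsInGraph.

(** * The block model at the chosen signal strength, for one pair of vertices *)

Section BlockModel.
Variables (R : realFieldType) (k : nat).
Hypothesis k_gt1 : (1 < k)%N.
Variables (lam : R).
Hypothesis lam_ge0 : 0 <= lam.

Definition block_signal (a b : 'I_k) : R := lam * (k%:R * (a == b)%:R - 1).

Let k_gt0 : (0 < k)%N. Proof. exact: ltnW. Qed.

Let kR_gt0 : 0 < k%:R :> R. Proof. by rewrite ltr0n. Qed.

Let kR_ge2 : 2 <= k%:R :> R. Proof. by rewrite ler_nat. Qed.

Lemma block_signal_sym a b : block_signal a b = block_signal b a.
Proof. by rewrite /block_signal eq_sym. Qed.

Lemma sum_delta (a : 'I_k) (u v : R) : \sum_(b < k) (u * (a == b)%:R + v) = u + k%:R * v.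
Proof.
rewrite big_split /= -mulr_sumr sumr_const card_ord -(mulr_natl v); congr (_ + _).
rewrite (bigD1 a) //= eqxx big1 ?addr0 ?mulr1 // => b /negPf ba.
by rewrite eq_sym ba.
Qed.

Lemma block_signal_mean0 a : \sum_b block_signal a b = 0.
Proof.
rewrite (eq_bigr (fun b => lam * k%:R * (a == b)%:R + - lam)); first by rewrite sum_delta; ring.
by move=> b _; rewrite /block_signal; ring.
Qed.

Lemma block_signal_bound a b : `|block_signal a b| <= lam * k%:R.
Proof.
rewrite /block_signal normrM ger0_norm //; apply: ler_wpM2l => //.
by rewrite ler_norml; case: (a == b); rewrite ?mulr1 ?mulr0; have := kR_ge2; lra.
Qed.

Lemma block_signal_mean_abs b : k%:R^-1 * \sum_a `|block_signal a b| <= 2 * lam.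
Proof.
rewrite mulrC ler_pdivrMr //.
apply: (@le_trans _ _ (\sum_(a < k) (lam * k%:R * (b == a)%:R + lam))).
  apply: ler_sum => a _; rewrite block_signal_sym /block_signal normrM ger0_norm //.
  rewrite -[X in _ <= _ + X]mulr1 -mulrA -mulrDr; apply: ler_wpM2l => //.
  by apply: (le_trans (ler_normB _ _)); rewrite normr1 ger0_norm // mulr_ge0.
by rewrite sum_delta le_eqVlt; apply/orP; left; apply/eqP; ring.
Qed.

Lemma block_signal_second_moment n (i j : 'I_n) : i != j ->
  label_mean (fun x : {ffun 'I_n -> 'I_k} => block_signal (x i) (x j) ^+ 2) = lam ^+ 2 * (k%:R - 1).
Proof.
move=> ij; rewrite -(label_mean_cond k_gt0 j) -[RHS](label_mean_cst n k_gt0).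
apply: eq_label_mean => x; rewrite /cond_mean.
under eq_bigr => b _ do rewrite relabelE relabel_neq //.
rewrite (eq_bigr (fun b => lam ^+ 2 * (k%:R ^+ 2 - 2 * k%:R) * (x i == b)%:R + lam ^+ 2)).
  by rewrite sum_delta; field; rewrite gt_eqF.
by move=> b _; rewrite /block_signal; case: (x i == b); rewrite /=; ring.
Qed.

Variables (n l : nat) (c : R).
Hypothesis c_gt0 : 0 < c.
Hypothesis c_le : c <= 2^-1.
Hypothesis n_gt0 : (0 < n)%N.
Hypothesis lam_sqr : lam ^+ 2 = c ^+ 2 / (64 * n%:R).
Hypothesis lam_k : lam * k%:R <= c / 8.
Hypothesis n_large : (2 * (k * (l + 3)) ^ 15 <= n)%N.
Notation lab := {ffun 'I_n -> 'I_k}.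

Lemma edge_prob_bounds (x : lab) p :
  7 * c / 8 <= edge_prob block_signal c x p <= 9 * c / 8.
Proof.
have := block_signal_bound (x p.1) (x p.2); rewrite /edge_prob ler_norml => /andP[h1 h2].
have h := lam_k; by apply/andP; split; lra.
Qed.

Lemma edge_prob_var (x : lab) p :
  (edge_prob block_signal c x p * (1 - edge_prob block_signal c x p))^-1 <= 4 / c.
Proof.
have [c0 c2] := (c_gt0, c_le).
have /andP[h1 h2] := edge_prob_bounds x p; set q := edge_prob _ _ _ _ in h1 h2 *.
have h : c / 4 <= q * (1 - q).
  (* From [c <= 1/2], 1 - q is at least 1 - 9/16 = 7/16. *)
  apply: (@le_trans _ _ (7 * c / 8 * (7 / 16))); first lra.
  by apply: ler_pM; lra.
rewrite -[4 / c]invrK invf_div lef_pV2 // posrE ?divr_gt0 //.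
by apply: lt_le_trans h; rewrite divr_gt0.
Qed.

(** The certificate started at the active set {i, j} costs at most eta^2 (lam k)^2 <= lam^2 / 4,
    against the second moment lam^2 (k - 1), and k >= 2. *)
Lemma pair_risk (i j : 'I_n) (g : {set 'I_n * 'I_n} -> R) : i != j -> spanned c l g ->
  lam ^+ 2 * k%:R / 4 <= label_mean (fun x : lab => graph_mean (edge_prob block_signal c x)
    (fun E => (g E - block_signal (x i) (x j)) ^+ 2)).
Proof.
move=> ij hg; have [c0 c2 k2] := And3 c_gt0 c_le kR_ge2.
(* The quadratic term of a step is of order (eta m^2)^2; exponent 6 makes it at most eta / 16 once m
   >= 4. [L] below counts [i], [j] and at most [l] further vertices. *)
pose M := (k * (l + 3))%N; pose m : R := M%:R; pose eta := m ^- 6.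
pose L := (l + 2)%N; pose G : R := L.*2%:R.
have M2k : (2 * k <= M)%N by rewrite /M mulnC leq_mul2l; apply/orP; right; rewrite addn3.
have m2k : 2 * k%:R <= m by rewrite -natrM ler_nat.
have m4 : 4 <= m by lra.
have m0 : 0 < m by lra.
have e0 : 0 < eta by rewrite invr_gt0 exprn_gt0.
have nR : 2 * m ^+ 15 <= n%:R by rewrite -natrX -natrM ler_nat.
have nR0 : 0 < n%:R :> R by rewrite ltr0n.
have Lm : L%:R <= m.
  rewrite ler_nat /L /M (leq_trans (_ : _ <= l + 3)%N) // ?leq_add2l //.
  by rewrite leq_pmull.
have Gk : G * k%:R <= 2 * m.
  rewrite /G /m -!natrM ler_nat -mul2n -mulnA leq_mul2l /= mulnC /M leq_mul2l.
  by rewrite leq_add2l orbT.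
have G0 : 0 < G by rewrite ltr0n /L addn2.
(* The ratio of the revisiting part L / eta of [t] to its main part n eta. *)
pose r := L%:R / (n%:R * eta ^+ 2).
have r_le : r <= 8^-1.
  rewrite ler_pdivrMr ?mulr_gt0 ?exprn_gt0 //.
  have : 2 * m ^+ 3 <= n%:R * eta ^+ 2.
    by rewrite /eta exprVn -exprM ler_pdivlMr ?exprn_gt0 // -mulrA -exprD.
  have : 16 * m <= m ^+ 3.
    have := ler_pM (_ : 0 <= 4) (_ : 0 <= 4) m4 m4 => /(_ ltac:(lra) ltac:(lra)) h.
    by rewrite !exprS expr0 mulr1 mulrC ler_wpM2l //; lra.
  by lra.
have r_ge0 : 0 <= r by rewrite divr_ge0 // mulr_ge0 // exprn_ge0 // ltW.
pose t : R := n%:R * eta + L%:R / eta.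
have tE : t = n%:R * eta * (1 + r).
  by rewrite /t /r; field; rewrite !gt_eqF.
(* The constant 64 in [lam_sqr] makes the linear term exactly this, at most 9/16 of [eta], which
   leaves room for the quadratic term. *)
have s1 : t * (4 * (4 / c) * (2 * lam) ^+ 2) = eta * (1 + r) * c.
  rewrite (_ : (2 * lam) ^+ 2 = 4 * (c ^+ 2 / (64 * n%:R))); last by rewrite -lam_sqr; ring.
  by rewrite tE; field; rewrite !gt_eqF.
have s2 : t * (4 * (4 / c) * (G * (lam * k%:R)) ^+ 2) = eta * (1 + r) * c / 4 * (G * k%:R) ^+ 2.
  rewrite (_ : (G * (lam * k%:R)) ^+ 2 = c ^+ 2 / (64 * n%:R) * (G * k%:R) ^+ 2); last first.
    by rewrite -lam_sqr; ring.
  by rewrite tE; field; rewrite !gt_eqF.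
have Gk2 : (G * k%:R) ^+ 2 <= 4 * m ^+ 2.
  rewrite (_ : 4 * m ^+ 2 = (2 * m) ^+ 2); last by ring.
  by apply: lerXn2r; rewrite ?nnegrE ?mulr_ge0 // ltW.
have b1 : eta * (1 + r) * c <= eta * (9 / 16).
  have rc : r * c <= 8^-1 * 2^-1 by apply: ler_pM => //; apply: ltW.
  have rc2 : (1 + r) * c <= 9 / 16 by lra.
  by rewrite -mulrA ler_wpM2l // ltW.
have em : eta * m ^+ 2 = m ^- 4 by rewrite /eta; field; rewrite gt_eqF.
have m4V : m ^- 4 <= 1 by rewrite invf_le1 ?exprn_gt0 // exprn_ege1 //; lra.
have r1_ge0 : 0 <= 1 + r by lra.
have P_ge0 : 0 <= eta * (1 + r) * c by apply: mulr_ge0; [apply: mulr_ge0 => //|]; apply: ltW.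
have b2 : eta * (1 + r) * c / 4 * (G * k%:R) ^+ 2 <= m ^- 4 * (9 / 16).
  rewrite -em; apply: (@le_trans _ _ (eta * (9 / 16) / 4 * (4 * m ^+ 2))).
    have b1' : eta * (1 + r) * c / 4 <= eta * (9 / 16) / 4 by lra.
    by apply: ler_pM; rewrite ?sqr_ge0 ?divr_ge0.
  by rewrite le_eqVlt; apply/orP; left; apply/eqP; field.
have h1 : t * (4 * (4 / c) * (G * (lam * k%:R)) ^+ 2) <= 1.
  rewrite s2; apply: (le_trans b2); lra.
have h2 : t * (4 * (4 / c) * (2 * lam) ^+ 2) +
    (t * (4 * (4 / c) * (G * (lam * k%:R)) ^+ 2)) ^+ 2 <= eta.
  have : (t * (4 * (4 / c) * (G * (lam * k%:R)) ^+ 2)) ^+ 2 <= (m ^- 4 * (9 / 16)) ^+ 2.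
    rewrite s2; apply: lerXn2r => //; rewrite nnegrE.
      by rewrite mulr_ge0 ?sqr_ge0 ?divr_ge0.
    by rewrite mulr_ge0 ?divr_ge0 ?invr_ge0 ?exprn_ge0 // ltW.
  have : (m ^- 4) ^+ 2 <= eta * 16^-1.
    rewrite (_ : (m ^- 4) ^+ 2 = eta * (m ^- 2)); last by rewrite /eta; field; rewrite gt_eqF.
    apply: ler_wpM2l; first exact: ltW.
    rewrite lef_pV2 ?posrE ?exprn_gt0 //.
    by rewrite (_ : 16 = 4 ^+ 2 :> R) ?ler_sqr ?nnegrE // ?ltW //; ring.
  by rewrite s1 exprMn; lra.
have eta1 : eta <= 1 by rewrite invf_le1 ?exprn_gt0 // exprn_ege1 //; lra.
have [||||||| a ha1 ha2] := @certificate R n k k_gt0 block_signal (lam * k%:R) (2 * lam) (4 / c) G eta L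
  block_signal_sym block_signal_mean0 block_signal_bound block_signal_mean_abs
  (mulr_ge0 lam_ge0 (ltW kR_gt0)) _ G0 (lexx _) e0 eta1 h1 h2 l [set i; j] set0
  (fun x => block_signal (x i) (x j)) (lam * k%:R).
- by rewrite divr_ge0 // ltW.
- by rewrite setU0 cards2 ij.
- by rewrite disjoint_sym disjoints_subset sub0set.
- by rewrite mulr_ge0 // ltW.
- by move=> x; apply: block_signal_bound.
- move=> u; rewrite !inE => /orP[] /eqP -> x; last first.
    by apply: cond_mean_edge; [exact: block_signal_mean0 | rewrite eq_sym].
  rewrite (@eq_cond_mean _ _ _ _ _ (fun x => block_signal (x j) (x i))).
    by apply: cond_mean_edge; [exact: block_signal_mean0 |].
  by move=> y; apply: block_signal_sym.
- move=> u; rewrite !inE orbF negb_or => /andP[ui uj] x b.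
  by rewrite !relabel_neq 1?eq_sym.
have pos x p : 0 < edge_prob block_signal c (x : lab) p.
  by have /andP[q1 q2] := edge_prob_bounds x p; apply: lt_le_trans q1; lra.
have lt1 x p : edge_prob block_signal c (x : lab) p < 1.
  by have /andP[q1 q2] := edge_prob_bounds x p; apply: le_lt_trans q2 _; lra.
apply: le_trans (correlation_bound pos lt1 edge_prob_var ha1 hg).
rewrite block_signal_second_moment // cards2 ij /= in ha2 *.
have ek : eta * k%:R <= 2^-1.
  have hm : eta * m <= 1.
    rewrite /eta ler_pdivrMl ?exprn_gt0 // mulr1 exprS -[leLHS]mulr1.
    by apply: ler_wpM2l; [exact: ltW | rewrite exprn_ege1 //; lra].
  have := ler_wpM2l (ltW e0) m2k; lra.
have ek2 : (eta * k%:R) ^+ 2 <= 4^-1.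
  rewrite (_ : 4^-1 = 2^-1 ^+ 2 :> R); last by field.
  by apply: lerXn2r => //; rewrite nnegrE ?invr_ge0 // mulr_ge0 // ltW.
have := ler_wpM2l (sqr_ge0 lam) ek2.
have -> : lam ^+ 2 * (eta * k%:R) ^+ 2 = eta ^+ 2 * (lam * k%:R) ^+ 2 by ring.
have := ler_wpM2l (sqr_ge0 lam) kR_ge2.
have := sqr_ge0 lam.
move: ha2; lra.
Qed.

End BlockModel.

(** * From one pair of vertices to the risk of the whole matrix *)

Lemma degree_budget n k l : (1 < k)%N -> (k ^ 1000 <= n)%N -> (l ^ 1000 <= n)%N ->
  (2 * (k * (l + 3)) ^ 15 <= n)%N.
Proof.
move=> k1 kn ln; pose m := maxn k l.
have mk : (k <= m)%N by apply: leq_maxl.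
have m1 : (1 < m)%N by apply: leq_trans mk.
have mn : (m ^ 1000 <= n)%N by rewrite /m /maxn; case: ifP.
(* Since m >= 2, l + 3 <= 4 m <= m^3, so the left side is at most m^61. *)
apply: leq_trans mn; apply: (@leq_trans (m * (m ^ 4) ^ 15)).
  apply: leq_mul => //; rewrite leq_exp2r // (expnS m 3); apply: leq_mul => //.
  have lm : (l <= m)%N by apply: leq_maxr.
  have m2 : (4 <= m * m)%N := leq_mul m1 m1.
  rewrite !expnS expn0 muln1; apply: leq_trans (leq_mul (leqnn m) m2).
  by rewrite mulnS leq_add // -[leqLHS]mul1n leq_mul // ltnW.
by rewrite -expnM -expnS leq_exp2l.
Qed.

Lemma ssbm_entryE (R : realType) (n k : nat) (c eps : R) (x : {ffun 'I_n -> 'I_k}) (i j : 'I_n) :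
  (0 < k)%N ->
  ssbm_entry c eps x i j = c + block_signal (eps * c / k%:R) (x i) (x j).
Proof.
move=> k0; have kR0 : k%:R != 0 :> R by rewrite pnatr_eq0 -lt0n.
have kp : k.-1%:R = k%:R - 1 :> R by rewrite -[in RHS](prednK k0) -natr1 addrK.
by rewrite /ssbm_entry /block_signal kp; case: (x i == x j) => /=; field.
Qed.

Lemma ssbm_riskE (R : realType) (n k : nat) (c eps : R) (f : 'M[R]_n -> 'M[R]_n) :
  (0 < k)%N ->
  ssbm_risk k c eps f = \sum_i \sum_j label_mean (fun x : {ffun 'I_n -> 'I_k} =>
    graph_mean (edge_prob (block_signal (eps * c / k%:R)) c x)
    (fun E => (f (adjacency R E) i j - c - block_signal (eps * c / k%:R) (x i) (x j)) ^+ 2)).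
Proof.
move=> k0; rewrite /ssbm_risk; under [RHS]eq_bigr => i _ do rewrite -label_mean_sum.
rewrite -label_mean_sum; apply: eq_bigr => x _; congr (_ * _).
under [RHS]eq_bigr => i _ do rewrite -graph_mean_sum.
rewrite -graph_mean_sum; apply: eq_bigr => E _; congr (_ * _).
  by apply: eq_bigr => p _; rewrite !ssbm_entryE.
apply: eq_bigr => i _; apply: eq_bigr => j _.
by rewrite !mxE ssbm_entryE // opprD addrA.
Qed.

Unset Implicit Arguments.

Theorem theoremE1 (R : realType) (c : R) :
  0 < c -> c <= 2^-1 ->
  exists2 C : R, 0 < C &
  exists N : nat, forall n k l : nat, (N <= n)%N ->
    (2 <= k)%N -> (k ^ 1000 <= n)%N -> (k %| n)%N -> (l ^ 1000 <= n)%N ->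
    forall f : 'M[R]_n -> 'M[R]_n, poly_map_deg l f ->
      exists2 eps : R, 0 <= eps <= 1 &
        C * k%:R * n%:R <= ssbm_risk k c eps f.
Proof.
(* There are n rows with n - 1 >= n/2 off-diagonal entries, each costing at least lam^2 k / 4, where
   lam^2 = c^2 / (64 n). *)
move=> c0 c2; exists (c ^+ 2 / 512).
  by rewrite divr_gt0 // exprn_gt0.
exists 2%N => n k l n2 k2 kn _ ln f [P [degP fP]].
have k0 : (0 < k)%N by apply: ltnW.
have n0 : (0 < n)%N by apply: ltnW.
have kR0 : 0 < k%:R :> R by rewrite ltr0n.
have nR0 : 0 < n%:R :> R by rewrite ltr0n.
have large := degree_budget k2 kn ln.
pose s := Num.sqrt (n%:R : R).
have s0 : 0 < s by rewrite sqrtr_gt0.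
have s2 : s ^+ 2 = n%:R by rewrite sqr_sqrtr // ltW.
have ks : k%:R <= s.
  rewrite -(ger0_norm (ltW kR0)) -sqrtr_sqr ler_wsqrtr // -natrX ler_nat.
  by apply: leq_trans kn; rewrite leq_exp2l.
pose eps := k%:R / (8 * s).
pose lam := eps * c / k%:R.
have lamE : lam = c / (8 * s).
  by rewrite /lam /eps; field; rewrite !gt_eqF.
have eps0 : 0 <= eps by rewrite divr_ge0 // mulr_ge0 // ltW.
exists eps.
  by rewrite eps0 ler_pdivrMr ?mulr_gt0 // mul1r; apply: (le_trans ks); lra.
have lam0 : 0 <= lam by rewrite lamE divr_ge0 ?mulr_ge0 // ltW.
have lam2 : lam ^+ 2 = c ^+ 2 / (64 * n%:R).
  by rewrite lamE -s2; field; rewrite gt_eqF.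
have lamk : lam * k%:R <= c / 8.
  have -> : lam * k%:R = c / 8 * (k%:R / s) by rewrite lamE; field; rewrite gt_eqF.
  rewrite -[leRHS]mulr1; apply: ler_wpM2l; first by rewrite divr_ge0 // ltW.
  by rewrite ler_pdivrMr // mul1r.
have lower i j : i != j -> lam ^+ 2 * k%:R / 4 <= label_mean (fun x : {ffun 'I_n -> 'I_k} =>
    graph_mean (edge_prob (block_signal lam) c x)
    (fun E => (f (adjacency R E) i j - c - block_signal lam (x i) (x j)) ^+ 2)).
  move=> ij; apply: (@pair_risk R k k2 lam lam0 n l c c0 c2 n0 lam2 lamk large i j
    (fun E => f (adjacency R E) i j - c)) => //.
  have cst1 : spanned c l (fun E : {set 'I_n * 'I_n} => 1).
    have := @spanned_edges R n c l set0 (sub0set _); rewrite cards0 => /(_ isT).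
    by apply: eq_spanned => E _; rewrite big_set0.
  have := spanned_lin (- c) cst1 (spanned_mpoly c (degP i j)).
  apply: eq_spanned => E _; rewrite mulr1 addrC; congr (_ - _).
  have sym : (adjacency R E)^T = adjacency R E.
    by apply/matrixP => u v; rewrite !mxE orbC.
  by have [_ ->] := fP _ sym.
rewrite ssbm_riskE // -/lam.
have row i : n.-1%:R * (lam ^+ 2 * k%:R / 4) <= \sum_j label_mean (fun x : {ffun 'I_n -> 'I_k} =>
    graph_mean (edge_prob (block_signal lam) c x)
    (fun E => (f (adjacency R E) i j - c - block_signal lam (x i) (x j)) ^+ 2)).
  (* The diagonal entry is only bounded below by zero. *)
  rewrite (bigD1 i) //= -[leLHS]add0r; apply: lerD.
    apply: label_mean_ge0 => x; apply: graph_mean_ge0 => [p | p | E]; last exact: sqr_ge0.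
      by have /andP[h _] := edge_prob_bounds k2 lam0 lamk x p; apply: lt_le_trans h; lra.
    by have /andP[_ h] := edge_prob_bounds k2 lam0 lamk x p; apply: le_lt_trans h _; lra.
  have -> : n.-1 = #|[pred j | j != i]|.
    by have := cardC (pred1 i); rewrite card1 card_ord add1n => /(congr1 predn) /= <-.
  rewrite mulr_natl -sumr_const; apply: ler_sum => j ji; apply: lower.
  by rewrite eq_sym.
apply: (@le_trans _ _ (\sum_(i < n) n.-1%:R * (lam ^+ 2 * k%:R / 4))); last by apply: ler_sum.
rewrite sumr_const card_ord -[leRHS]mulr_natl lam2.
have n1 : n%:R / 2 <= n.-1%:R :> R.
  have : 2 <= n%:R :> R by rewrite ler_nat.
  have : n%:R = n.-1%:R + 1 :> R by rewrite natr1 prednK.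
  lra.
have -> : c ^+ 2 / 512 * k%:R * n%:R = n%:R * (n%:R / 2 * (c ^+ 2 / (64 * n%:R) * k%:R / 4)).
  by field; rewrite gt_eqF.
apply: ler_wpM2l; first exact: ltW.
apply: ler_wpM2r => //.
by rewrite divr_ge0 // mulr_ge0 ?divr_ge0 ?sqr_ge0 ?mulr_ge0 // ltW.
Qed.
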